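(* Let $q$ be a power of a prime $p$, $K$ an algebraic closure of $\mathbb{F}_q$, and let $\overline{\mathrm{AGL}}(2,q)$ denote the stabilizer in $\mathrm{PGL}(3,q)$ of a point of $\mathrm{PG}(2,q)$, acting on $\mathrm{PG}(2,K)$. Then $d(\overline{\mathrm{AGL}}(2,q))=q^3-q^2$.
   Context: Plane curves are projective plane curves over $K$; irreducible means irreducible over $K$; a curve is $G$-invariant if every element of $G$ maps it onto itself. $d(G)$ is the smallest degree of a $G$-invariant irreducible plane curve other than a line (it does not depend on the choice of the point, up to conjugacy). *)

(* Defs.v *)
From HB Require Import structures.
From mathcomp Require Import all_boot all_order all_algebra.
From mathcomp Require Import mpoly.
Set Implicit Arguments. Unset Strict Implicit. Unset Printing Implicit Defensive.
Import Order.TTheory GRing.Theory.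
Local Open Scope ring_scope.

(* Plane projective curves over K are represented by nonzero homogeneous
   polynomials F in K[X_0,X_1,X_2] (up to a nonzero scalar); the curve has
   degree d when F is d-homogeneous. *)

Definition entries_in_Fq (K : fieldType) (q : nat) (m n : nat) (A : 'M[K]_(m, n)) : Prop :=
  forall i j, A i j ^+ q = A i j.

Definition irreducible_mpoly (K : fieldType) (F : {mpoly K[3]}) : Prop :=
  (1 < msize F)%N /\
  forall G H : {mpoly K[3]}, F = G * H -> (msize G <= 1)%N \/ (msize H <= 1)%N.

Definition lin_subst (K : fieldType) (A : 'M[K]_3) : 3.-tuple {mpoly K[3]} :=
  [tuple \sum_(j < 3) A i j *: 'X_j | i < 3].

(* Preimage in GL(3,q) of the stabilizer in PGL(3,q) of the point [P]
   of PG(2,q) (scalars act trivially on curves, so this gives the same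
   invariant curves as the subgroup of PGL(3,q)). *)
Definition in_stab_point (K : fieldType) (q : nat) (P : 'cV[K]_3) (A : 'M[K]_3) : Prop :=
  entries_in_Fq q A /\ A \in unitmx /\ exists c : K, A *m P = c *: P.

Definition curve_invariant (K : fieldType) (G : 'M[K]_3 -> Prop) (F : {mpoly K[3]}) : Prop :=
  forall A, G A -> exists c : K, F \mPo lin_subst A = c *: F.

Definition invariant_irreducible_curve (K : fieldType) (G : 'M[K]_3 -> Prop)
    (d : nat) (F : {mpoly K[3]}) : Prop :=
  F \is [in K[3], d.-homog] /\ irreducible_mpoly F /\ curve_invariant G F.

(* Main.v *)
Require Import Defs.
From HB Require Import structures.
From mathcomp Require Import all_boot all_order all_algebra perm separable.
From mathcomp Require Import mpoly ring zify.
Set Implicit Arguments. Unset Strict Implicit. Unset Printing Implicit Defensive.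
Import GRing.Theory.
Local Open Scope ring_scope.

(** Take P = (0:0:1).  The group contains all Z -> cZ + aX + bY with a, b, c in
    F_q, c <> 0.  If F is invariant and not divisible by Z, then for general x the
    polynomial f(z) = F(x,1,z) is invariant under z -> cz + ax + b, so f - f(z0)
    has q^2(q-1) roots unless f is constant, in which case F is a binary form and
    splits into lines.

    The bound is attained by V^(q-1) = Q^q, where V is the product of all
    Z + aX + bY and Q is the Dickson invariant of degree q^2 - q in X, Y.  Let A be
    a factor of minimal degree.  Through each point of this curve on X = 0, and
    through each point with Z = Q = 0, passes a single branch; the former points
    are fixed by Z -> Z + aX, the latter by Z -> cZ.  Hence A and its transforms
    have a common point at which the curve is unibranch, which forces A to be
    invariant under all Z -> cZ + aX + bY, and the first argument applied to A
    shows that A is the whole curve. *)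

(** * Evaluation of K[x][z] in [K]-algebras *)

Section Evaluation.
Variable K : fieldType.
Implicit Types (A B : {poly {poly K}}).

(** Values lie in an arbitrary [K]-algebra, so that points, lines through a point and weighted
    substitutions are treated alike and compared by naturality. In [{poly {poly K}}] the inner
    variable is x and the outer one is z. *)
Definition ev1 (E : comNzRingType) (e : {rmorphism K -> E}) (x : E) : {rmorphism {poly K} -> E} :=
  horner_eval x \o map_poly e.

Definition ev2 (E : comNzRingType) (e : {rmorphism K -> E}) (x z : E) :
    {rmorphism {poly {poly K}} -> E} :=
  horner_eval z \o map_poly (ev1 e x).

Lemma ev1X (E : comNzRingType) (e : {rmorphism K -> E}) (x : E) : ev1 e x 'X = x.
Proof. by rewrite -[LHS]/((map_poly e 'X).[x]) map_polyX hornerX. Qed.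

Lemma ev1C (E : comNzRingType) (e : {rmorphism K -> E}) (x : E) c : ev1 e x c%:P = e c.
Proof. by rewrite -[LHS]/((map_poly e c%:P).[x]) map_polyC hornerC. Qed.

Lemma ev2Z (E : comNzRingType) (e : {rmorphism K -> E}) (x z : E) : ev2 e x z 'X = z.
Proof. by rewrite -[LHS]/((map_poly (ev1 e x) 'X).[z]) map_polyX hornerX. Qed.

Lemma ev2C (E : comNzRingType) (e : {rmorphism K -> E}) (x z : E) a : ev2 e x z a%:P = ev1 e x a.
Proof. by rewrite -[LHS]/((map_poly (ev1 e x) a%:P).[z]) map_polyC hornerC. Qed.

Lemma rmorph_ev1 (E E' : comNzRingType) (e : {rmorphism K -> E}) (e' : {rmorphism K -> E'})
    (h : {rmorphism E -> E'}) (x : E) a :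
  (forall c, h (e c) = e' c) -> h (ev1 e x a) = ev1 e' (h x) a.
Proof.
move=> he; rewrite -[LHS]/(h (map_poly e a).[x]) -horner_map -map_poly_comp.
by rewrite -[RHS]/((map_poly e' a).[h x]); congr (_.[_]); apply: eq_map_poly.
Qed.

Lemma rmorph_ev2 (E E' : comNzRingType) (e : {rmorphism K -> E}) (e' : {rmorphism K -> E'})
    (h : {rmorphism E -> E'}) (x z : E) A :
  (forall c, h (e c) = e' c) -> h (ev2 e x z A) = ev2 e' (h x) (h z) A.
Proof.
move=> he; rewrite -[LHS]/(h (map_poly (ev1 e x) A).[z]) -horner_map -map_poly_comp.
rewrite -[RHS]/((map_poly (ev1 e' (h x)) A).[h z]); congr (_.[_]); apply: eq_map_poly => c.
exact: (rmorph_ev1 _ _ he).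
Qed.

Definition idK : {rmorphism K -> K} := idfun.
Definition cK : {rmorphism K -> {poly K}} := polyC.
Definition ccK : {rmorphism K -> {poly {poly K}}} := polyC \o polyC.
Definition cccK : {rmorphism K -> {poly {poly {poly K}}}} := polyC \o ccK.

End Evaluation.

(** * Orders of vanishing and a criterion for a single branch *)

Lemma dvd_Xn_order (D : idomainType) (P : {poly D}) :
  P != 0 -> exists mu P1, P = 'X^mu * P1 /\ P1.[0] != 0.
Proof.
move=> P0; have [m [Q]] := multiplicity_XsubC P 0.
rewrite P0 subr0 /= => rQ ->; exists m, Q; rewrite mulrC; split => //.
Qed.

Lemma Xn_dvd_le (D : idomainType) (P1 R : {poly D}) N mu :
  'X^N * R = 'X^mu * P1 -> P1.[0] != 0 -> (N <= mu)%N.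
Proof.
move=> e; apply: contraNT; rewrite -ltnNge => lt.
move: e; rewrite -(subnKC (ltnW lt)) exprD -mulrA => /mulfI.
rewrite expf_eq0 polyX_eq0 andbF => /(_ isT) <-.
by rewrite hornerM hornerXn expr0n subn_eq0 leqNgt lt mul0r.
Qed.

(** Here [i, i'] and [j, j'] are the orders of two factors along the vertical and the horizontal
    line through a point, and [mu, mu'] their weighted orders. All the estimates are forced to be
    equalities, so [i * m = j * n], and coprimality gives [n %| i] although [0 < i < n]. *)
Lemma coprime_slopes (m n i i' j j' mu mu' : nat) :
  (0 < m)%N -> (0 < n)%N -> coprime m n -> (0 < i)%N -> (0 < i')%N ->
  (mu <= i * m)%N -> (mu <= j * n)%N -> (mu' <= i' * m)%N -> (mu' <= j' * n)%N ->
  (i + i' <= n)%N -> (j + j' <= m)%N -> (m * n <= mu + mu')%N -> False.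
Proof.
move=> m0 n0 cop i0 i0' h1 h2 h3 h4 h5 h6 h7.
have eq1 : (i * m = j * n)%N by nia.
have /dvdn_leq : (n %| i)%N by rewrite -(Gauss_dvdl i (p := m)) 1?coprime_sym // eq1 dvdn_mull.
by move: i0 i0' h5; clear; lia.
Qed.

(* The form of lowest weight of [f] at [(x0,z0)], for the weights [n] of [x] and
   [m] of [z], is [alpha z^n + beta x^m]; as [m] and [n] are coprime it is not a
   product of two nonconstant quasi-homogeneous forms. *)
Lemma local_unibranch (K : fieldType) (f A B : {poly {poly K}}) (x0 z0 : K) (m n : nat)
    (R : {poly {poly {poly K}}}) (g h : {poly K}) :
  (0 < m)%N -> (0 < n)%N -> coprime m n ->
  f = A * B ->
  ev2 (idK K) x0 z0 A = 0 -> ev2 (idK K) x0 z0 B = 0 ->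
  ev2 (cccK K) (cccK K x0 + ('X : {poly {poly K}})%:P * 'X^n)
               (cccK K z0 + (('X : {poly K})%:P)%:P * 'X^m) f = 'X^(m * n) * R ->
  ev2 (cK K) (cK K x0) (cK K z0 + 'X) f = 'X^n * g -> g.[0] != 0 ->
  ev2 (cK K) (cK K x0 + 'X) (cK K z0) f = 'X^m * h -> h.[0] != 0 ->
  False.
Proof.
move=> m0 n0 cop fAB A0 B0.
set phi := ev2 _ _ _ => phif f1 g0 f2 h0.
have nz1 : ev2 (cK K) (cK K x0) (cK K z0 + 'X) f != 0.
  rewrite f1 mulf_neq0 ?expf_neq0 ?polyX_eq0 //.
  by apply: contraNneq g0 => ->; rewrite horner0.
have nz2 : ev2 (cK K) (cK K x0 + 'X) (cK K z0) f != 0.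
  rewrite f2 mulf_neq0 ?expf_neq0 ?polyX_eq0 //.
  by apply: contraNneq h0 => ->; rewrite horner0.
(* In the substitution (x0 + X t^n, z0 + Z t^m), [sp a b] sets X = a and Z = b and keeps t. Thus
   [sp 0 1] restricts to the vertical line with t^m for t, and [sp 1 0] to the horizontal line with
   t^n for t. *)
pose sp (a b : K) : {rmorphism {poly {poly {poly K}}} -> {poly K}} :=
  map_poly (ev2 (idK K) b a).
have spX a b : sp a b 'X = 'X by rewrite /sp /= map_polyX.
have spC a b c : sp a b (cccK K c) = cK K c.
  rewrite /sp /cccK /= map_polyC; congr (_%:P).
  by rewrite [LHS](ev2C (idK K)) ev1C.
have spx a b : sp a b ('X : {poly {poly K}})%:P = a%:P.
  rewrite /sp /= map_polyC; congr (_%:P).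
  exact: (ev2Z (idK K)).
have spz a b : sp a b (('X : {poly K})%:P)%:P = b%:P.
  rewrite /sp /= map_polyC; congr (_%:P).
  by rewrite [LHS](ev2C (idK K)) ev1X.
pose cp (l : nat) : {rmorphism {poly K} -> {poly K}} := comp_poly ('X^l).
have cpX l : cp l 'X = 'X^l by rewrite /cp /= comp_polyX.
have cpC l c : cp l (cK K c) = cK K c by rewrite /cp /= comp_polyC.
have sp1 C : sp 0 1 (phi C) = cp m (ev2 (cK K) (cK K x0) (cK K z0 + 'X) C).
  rewrite (rmorph_ev2 _ _ _ (spC 0 1)) (rmorph_ev2 _ _ _ (cpC m)).
  rewrite !rmorphD !rmorphM !rmorphXn !spX !spC spx spz !cpC cpX.
  by rewrite rmorph0 mul0r addr0 mul1r.
have sp2 C : sp 1 0 (phi C) = cp n (ev2 (cK K) (cK K x0 + 'X) (cK K z0) C).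
  rewrite (rmorph_ev2 _ _ _ (spC 1 0)) (rmorph_ev2 _ _ _ (cpC n)).
  rewrite !rmorphD !rmorphM !rmorphXn !spX !spC spx spz !cpC cpX.
  by rewrite rmorph0 mul0r addr0 mul1r.
have cp0 l (P : {poly K}) : (0 < l)%N -> (cp l P).[0] = P.[0].
  by move=> l0; rewrite /cp /= horner_comp hornerXn expr0n; case: l l0.
(* Specialising X and Z can only raise the order in t, which bounds the weighted order [mu] of a
   factor by [i * m] and by [j * n]. *)
have fact C : ev2 (idK K) x0 z0 C = 0 ->
    ev2 (cK K) (cK K x0) (cK K z0 + 'X) C != 0 ->
    ev2 (cK K) (cK K x0 + 'X) (cK K z0) C != 0 ->
  exists i j mu, [/\ [/\ (0 < i)%N, (0 < j)%N, (mu <= i * m)%N & (mu <= j * n)%N],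
    exists2 C1, ev2 (cK K) (cK K x0) (cK K z0 + 'X) C = 'X^i * C1 & C1.[0] != 0,
    exists2 C1, ev2 (cK K) (cK K x0 + 'X) (cK K z0) C = 'X^j * C1 & C1.[0] != 0 &
    exists2 C1, phi C = 'X^mu * C1 & C1.[0] != 0].
  move=> C0 nC1 nC2.
  have nphi : phi C != 0.
    apply: contraNneq nC1 => phi0; move: (sp1 C); rewrite phi0 rmorph0.
    move=> /esym/eqP; rewrite /cp /= comp_poly_eq0 ?size_polyXn //.
  have [i [C1 [e1 nz_1]]] := dvd_Xn_order nC1.
  have [j [C2 [e2 nz_2]]] := dvd_Xn_order nC2.
  have [mu [C3 [e3 nz_3]]] := dvd_Xn_order nphi.
  pose ev0 : {rmorphism {poly K} -> K} := horner_eval 0.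
  have ev0C c : ev0 (cK K c) = idK K c by rewrite [LHS]hornerC.
  have ev0X : ev0 'X = 0 by rewrite [LHS]hornerX.
  exists i, j, mu; split; last 3 first.
  - by exists C1. - by exists C2. - by exists C3.
  split.
  - case: i e1 => // e1; move: nz_1; rewrite -[C1]mul1r -(expr0 'X) -e1.
    move/negP; case; apply/eqP; rewrite -[RHS]C0.
    by rewrite -[LHS]/(ev0 _) (rmorph_ev2 _ _ _ ev0C) rmorphD !ev0C ev0X addr0.
  - case: j e2 => // e2; move: nz_2; rewrite -[C2]mul1r -(expr0 'X) -e2.
    move/negP; case; apply/eqP; rewrite -[RHS]C0.
    by rewrite -[LHS]/(ev0 _) (rmorph_ev2 _ _ _ ev0C) rmorphD !ev0C ev0X addr0.
  - have := sp1 C; rewrite e1 e3 !rmorphM !rmorphXn spX cpX -exprM mulnC => /Xn_dvd_le.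
    by apply; rewrite cp0.
  - have := sp2 C; rewrite e2 e3 !rmorphM !rmorphXn spX cpX -exprM mulnC => /Xn_dvd_le.
    by apply; rewrite cp0.
move: nz1 nz2 f1 f2 phif; rewrite fAB !rmorphM !mulf_eq0 !negb_or.
move=> /andP[a1 b1] /andP[a2 b2].
have [i [j [mu [[i0 j0 mi mj] [A1 -> A10] [A2 -> A20] [A3 -> A30]]]]] := fact A A0 a1 a2.
have [i' [j' [mu' [[i0' j0' mi' mj'] [B1 -> B10] [B2 -> B20] [B3 -> B30]]]]] := fact B B0 b1 b2.
rewrite !(mulrACA _ _ 'X^_ _) -!exprD => f1 f2 f3.
have le1 : (i + i' <= n)%N by apply: (Xn_dvd_le f1).
have le2 : (j + j' <= m)%N by apply: (Xn_dvd_le f2).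
have le3 : (m * n <= mu + mu')%N.
  by apply: (Xn_dvd_le (esym f3)); rewrite hornerM mulf_neq0.
exact: (coprime_slopes m0 n0 cop i0 i0' mi mj mi' mj' le1 le2 le3).
Qed.

(** * Monic factors in K[x][z] *)

Section MonicFactors.
Variable K : closedFieldType.
Implicit Types (A B D E f : {poly {poly K}}).

Lemma divide_content (x0 : K) D :
  map_poly (horner_eval x0) D = 0 ->
  exists D', D = ('X - x0%:P) *: D' /\ size D' = size D.
Proof.
move=> D0; pose h (a : {poly K}) : {poly K} := (a %/ ('X - x0%:P))%R.
have h0 : h 0 = 0 by rewrite /h div0p.
have e : D = ('X - x0%:P) *: map_poly h D.
  apply/polyP => i; rewrite coefZ coef_map_id0 // mulrC.
  apply/esym/divpK; rewrite dvdp_XsubCl; apply/rootP.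
  by have /(congr1 (fun P : {poly K} => P`_i)) := D0; rewrite coef_map coef0.
exists (map_poly h D); split => //.
by rewrite {2}e size_scale // polyXsubC_eq0.
Qed.

(* The primes of [K[x]] are the [x - x0], so a content [c] can be removed root by root. *)
Lemma gauss_factor A D E (c : {poly K}) :
  c != 0 -> c *: A = D * E -> exists D' E', A = D' * E' /\ size D' = size D.
Proof.
have [n] := ubnP (size c); elim: n c A D E => // n IHn c A D E ltcn c0 cA.
have [/size_poly1P [k k0 ck]|sc] := boolP (size c == 1%N).
  exists D, ((k^-1)%:P *: E); split => //.
  by rewrite -scalerAr -cA scalerA ck -polyCM mulVf // scale1r.
have [x0 /factor_theorem [c' cc']] := closed_rootP c sc.
have x0P : 'X - x0%:P != 0 :> {poly K} by rewrite polyXsubC_eq0.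
have c'0 : c' != 0 by apply: contraNneq c0 => c'0; rewrite cc' c'0 mul0r.
have ltc' : (size c' < n)%N.
  by move: ltcn; rewrite cc' size_Mmonic ?monicXsubC // size_XsubC addn2.
(* At x = x0 the product of the two factors becomes zero over a domain, so all coefficients of one
   of them are divisible by x - x0. *)
have prod0 : map_poly (horner_eval x0) D * map_poly (horner_eval x0) E = 0.
  rewrite -rmorphM -cA -mul_polyC rmorphM /= map_polyC /= {1}/horner_eval cc'.
  by rewrite hornerM hornerXsubC subrr mulr0 mul0r.
have scI (P Q : {poly {poly K}}) : ('X - x0%:P) *: P = ('X - x0%:P) *: Q -> P = Q.
  move=> /eqP; rewrite -subr_eq0 -scalerBr -mul_polyC mulf_eq0 polyC_eq0 (negPf x0P).
  by rewrite subr_eq0 => /eqP.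
move: (prod0) => /eqP; rewrite mulf_eq0 => /orP[] /eqP /divide_content [P [eP sP]].
- have [] := IHn c' A P E ltc' c'0; last by move=> D' [E' [-> sD']]; exists D', E'; rewrite sD'.
  by apply: scI; rewrite scalerA mulrC -cc' cA {1}eP -scalerAl.
- have [] := IHn c' A D P ltc' c'0; last by move=> D' [E' [-> sD']]; exists D', E'.
  by apply: scI; rewrite scalerA mulrC -cc' cA {1}eP -scalerAr.
Qed.

Lemma lead_coef_factor_unit D E : D * E \is monic -> lead_coef D \is a GRing.unit.
Proof.
by move=> /monicP; rewrite lead_coefM => e; apply/unitrPr; exists (lead_coef E).
Qed.

Lemma monic_factor A D E : A \is monic -> A = D * E ->
  exists D' E', [/\ A = D' * E', size D' = size D & D' \is monic].
Proof.
move=> mA AE; have u : lead_coef D \is a GRing.unit.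
  by apply: (@lead_coef_factor_unit _ E); rewrite -AE.
exists ((lead_coef D)^-1 *: D), (lead_coef D *: E); split.
- by rewrite -scalerAl -scalerAr scalerA mulVr // scale1r.
- by rewrite size_scale // invr_eq0; apply: contraTneq u => ->; rewrite unitr0.
- by rewrite monicE lead_coefZ mulVr.
Qed.

(** Only degree 0 in z is excluded: a monic nonconstant [f] is such a factor of itself, and
    irreducibility will mean that a factor of minimal degree has full degree. *)
Definition proper_monic_factor f A := [/\ A \is monic, (1 < size A)%N & exists B, f = A * B].

Definition minimal_monic_factor f A := proper_monic_factor f A /\
  forall A', proper_monic_factor f A' -> (size A <= size A')%N.

(** If the gcd of [A] and [A'] has positive degree in z, it yields a monic factor of [f] of that
    degree; by minimality the gcd has the degree of both, and the two monic polynomials coincide.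
    Otherwise they are coprime and their product divides [f]. *)
Lemma minimal_factor_dichotomy f A A' :
  f \is monic -> minimal_monic_factor f A -> proper_monic_factor f A' -> size A' = size A ->
  A' = A \/ exists C, f = (A * A') * C.
Proof.
move=> mf [[mA sA [B fB]] minA] [mA' sA' [B' fB']] ss.
have [cop|ncop] := boolP (coprimep A A').
  (* Here [%|] is divisibility up to a factor from K[x]; it becomes exact because [A * A'] is
     monic. *)
  right; have := Pdiv.Idomain.Gauss_dvdp f cop.
  have -> : A %| f by rewrite fB Pdiv.Idomain.dvdp_mulr.
  have -> : A' %| f by rewrite fB' Pdiv.Idomain.dvdp_mulr.
  by move=> /(Pdiv.IdomainMonic.dvdpP (rpredM mA mA')) [C ->]; exists C; rewrite mulrC.
left; set D := gcdp A A'.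
have A0 := monic_neq0 mA; have D0 : D != 0 by rewrite Pdiv.Idomain.gcdp_eq0 (negPf A0).
have sD1 : (1 < size D)%N.
  by rewrite ltn_neqAle eq_sym ncop size_poly_gt0.
have /Pdiv.Idomain.dvdpP [[c Q] /= c0 cA] : D %| A by apply: Pdiv.Idomain.dvdp_gcdl.
have [D1 [E1 [AE sE1]]] := gauss_factor c0 (etrans cA (mulrC _ _)).
have [D2 [E2 [AE2 sE2 mD2]]] := monic_factor mA AE.
have leA : (size A <= size D)%N.
  rewrite -sE1 -sE2; apply: minA; split; rewrite ?sE2 ?sE1 //.
  by exists (E2 * B); rewrite mulrA -AE2.
have eqA (P : {poly {poly K}}) : P != 0 -> size P = size A -> D %| P -> D %= P.
  move=> P0 sP dP; rewrite -Pdiv.Idomain.dvdp_size_eqp // eqn_leq Pdiv.Idomain.dvdp_leq // sP leA //.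
have e1 := eqA A A0 erefl (Pdiv.Idomain.dvdp_gcdl _ _).
have e2 := eqA A' (monic_neq0 mA') ss (Pdiv.Idomain.dvdp_gcdr _ _).
have : A' %= A by rewrite (Pdiv.Idomain.eqp_ltrans e2) in e1.
case/Pdiv.Idomain.eqpP => -[c1 c2] /= /andP[c10 c20] e.
have /(congr1 lead_coef) := e.
rewrite !lead_coefZ (monicP mA) (monicP mA') !mulr1 => cc.
move/eqP: e; rewrite cc -subr_eq0 -scalerBr -mul_polyC mulf_eq0 polyC_eq0 (negPf c20).
by rewrite subr_eq0 => /eqP.
Qed.

(** By induction on the degree every monic factor of positive degree is minimal: a smaller one would
    already have the full degree of [f]. So one of two complementary factors takes up the whole
    degree. *)
Lemma proper_factors_trivial f :
  f \is monic -> (forall A, minimal_monic_factor f A -> size A = size f) ->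
  forall G H, f = G * H -> (size G <= 1)%N \/ (size H <= 1)%N.
Proof.
move=> mf mini.
have all_factors A : proper_monic_factor f A -> size A = size f.
  have [n] := ubnP (size A); elim: n A => // n IHn A ltA fA.
  apply: mini; split => // A' fA'; rewrite leqNgt; apply/negP => lt.
  have := IHn A' (leq_trans lt ltA) fA' => sA'; case: fA => mA sA [B fB].
  have : (size A <= size f)%N.
    by apply: Pdiv.Idomain.dvdp_leq; rewrite ?monic_neq0 // fB Pdiv.Idomain.dvdp_mulr.
  by rewrite -sA' leqNgt lt.
move=> G H fGH; case: (leqP (size G) 1) => [|sG]; [by left|right].
have [D [E [fDE sD mD]]] := monic_factor mf fGH.
have := all_factors D; rewrite sD => sf.
have f0 := monic_neq0 mf; move: (f0); rewrite {1}fGH mulf_eq0 negb_or => /andP[G0 H0].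
have := size_mul G0 H0; rewrite -fGH -sf; last first.
  by split; rewrite ?sD //; exists E.
move: H0 sG; rewrite -size_poly_gt0; clear. by case: (size G) => // a; case: (size H) => // b _ _; lia.
Qed.

End MonicFactors.

(** * Powers modulo an element, and points where a polynomial is nonzero *)

Lemma exprD_mod (E : comNzRingType) (a b T : E) n : exists c, (a + T * b) ^+ n = a ^+ n + T * c.
Proof.
have := subrXX (a + T * b) a n; rewrite [a + _ - a]addrC addKr -mulrA.
by set c := b * _ => /(canRL (subrK _)) ->; exists c; rewrite addrC.
Qed.

(** [P] cannot vanish at a root of the nonconstant polynomial [P * 'X + 1]. *)
Lemma closed_field_nonroot (K : closedFieldType) (P : {poly K}) : P != 0 -> exists x, P.[x] != 0.
Proof.
move=> P0; have /closed_rootP [x] : size (P * 'X + 1%:P) != 1%N.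
  by rewrite size_MXaddC (negPf P0) /= eqSS size_poly_eq0.
rewrite /root hornerD hornerMX hornerC => /eqP e; exists x.
by apply: contra_eq_neq e => ->; rewrite mul0r add0r oner_neq0.
Qed.

(** * The curve in the chart y = 1 and its local expansions *)

Section Dickson.
Variables (p k : nat) (K : closedFieldType).
Hypotheses (pr_p : prime p) (k_gt0 : (0 < k)%N) (chK : p \in [pchar K]).
Local Notation q := (p ^ k)%N.

Lemma q_gt1 : (1 < q)%N.
Proof. by rewrite -(exp1n k) ltn_exp2r ?prime_gt1. Qed.

Lemma q_gt0 : (0 < q)%N.
Proof. exact: ltnW q_gt1. Qed.

Lemma expr0q (E : pzSemiRingType) : 0 ^+ q = 0 :> E.
Proof. by rewrite expr0n gtn_eqF ?q_gt0. Qed.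

Lemma expr0q1 (E : pzSemiRingType) : 0 ^+ q.-1 = 0 :> E.
Proof. by rewrite expr0n; have := q_gt1; case: (q) => [|[]]. Qed.

Lemma exprSq (E : pzSemiRingType) (x : E) : x ^+ q = x * x ^+ q.-1.
Proof. by rewrite -exprS prednK ?q_gt0. Qed.

(** Differences of (q-1)-th powers below have a cofactor which at 0 is a sum of q - 1 equal terms;
    this makes it nonzero. *)
Lemma pred_q_natr : q.-1%:R = -1 :> K.
Proof.
have : q%:R = 0 :> K by rewrite natrX (pcharf0 chK) expr0n; case: k k_gt0.
by rewrite -(prednK q_gt0) -natr1 => /eqP; rewrite addr_eq0 => /eqP.
Qed.

Lemma frobD (E : comNzRingType) (e : {rmorphism K -> E}) (x y : E) :
  (x + y) ^+ q = x ^+ q + y ^+ q.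
Proof.
by apply: exprDn_pchar; rewrite pnatX pnatE // (rmorph_pchar e).
Qed.

Lemma frobB (E : comNzRingType) (e : {rmorphism K -> E}) (x y : E) :
  (x - y) ^+ q = x ^+ q - y ^+ q.
Proof. by apply/eqP; rewrite eq_sym subr_eq -(frobD e) subrK. Qed.

(* The curve in the chart y = 1: the base of the first power is V(x,1,z), that of the
   last one is Q(x,1). *)
Definition fexp (E : pzRingType) (x z : E) : E :=
  let w := z ^+ q - z in let u := x ^+ q - x in
  (w ^+ q - u ^+ q.-1 * w) ^+ q.-1 - (1 + u ^+ q.-1) ^+ q.

Lemma rmorph_fexp (E E' : pzRingType) (h : {rmorphism E -> E'}) (x z : E) :
  h (fexp x z) = fexp (h x) (h z).
Proof. by rewrite /fexp !(rmorphB, rmorphXn, rmorphD, rmorphM, rmorph1). Qed.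

Lemma frobB_mul (E : comNzRingType) (x t : E) :
  (x * t) ^+ q - x * t = t * (x ^+ q * t ^+ q.-1 - x).
Proof. by rewrite exprMn (exprSq t); ring. Qed.

(** Near a point of x = 0 give x weight q and z weight q - 1. Then w changes by a multiple of
    t^(q-1), hence w^q by one of t^(q(q-1)), and u^(q-1) is itself divisible by t^(q(q-1)); the
    remaining constants cancel by hypothesis. *)
Lemma fexp_weight1 (E : comNzRingType) (e : {rmorphism K -> E}) (x t z : E) (zeta : K) :
  (zeta ^+ q - zeta) ^+ (q * q.-1) = 1 ->
  exists R, fexp (e 0 + x * t ^+ q) (e zeta + z * t ^+ q.-1) = t ^+ (q.-1 * q) * R.
Proof.
move=> w0; rewrite /fexp rmorph0 add0r (frobD e (e zeta)).
have -> : e zeta ^+ q + (z * t ^+ q.-1) ^+ q - (e zeta + z * t ^+ q.-1)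
  = (e zeta ^+ q - e zeta) + ((z * t ^+ q.-1) ^+ q - z * t ^+ q.-1) by ring.
rewrite !frobB_mul -rmorphXn -rmorphB; set w := e _.
set w' := (z ^+ q * _ - z); set u' := (x ^+ q * _ - x).
rewrite [X in X - _ * _](frobD e) !exprMn -!exprM (mulnC q q.-1).
set T := t ^+ (q.-1 * q); set U := u' ^+ _.
have -> : w ^+ q + T * w' ^+ q - T * U * (w + t ^+ q.-1 * w')
  = w ^+ q + T * (w' ^+ q - U * (w + t ^+ q.-1 * w')) by ring.
have [c ->] := exprD_mod (w ^+ q) (w' ^+ q - U * (w + t ^+ q.-1 * w')) T q.-1.
have [d ->] := exprD_mod 1 U T q.
exists (c - d); rewrite -exprM /w -rmorphXn w0 rmorph1 expr1n; ring.
Qed.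

(** Near a point with z = Q = 0 the weights are exchanged: Q is divisible by t^(q-1) and V by t^q,
    so Q^q and V^(q-1) are both divisible by t^(q(q-1)). *)
Lemma fexp_weight2 (E : comNzRingType) (e : {rmorphism K -> E}) (x t z : E) (om : K) :
  1 + (om ^+ q - om) ^+ q.-1 = 0 ->
  exists R, fexp (e om + x * t ^+ q.-1) (e 0 + z * t ^+ q) = t ^+ (q * q.-1) * R.
Proof.
move=> w0; rewrite /fexp rmorph0 add0r (frobD e (e om)).
have -> : e om ^+ q + (x * t ^+ q.-1) ^+ q - (e om + x * t ^+ q.-1)
  = (e om ^+ q - e om) + ((x * t ^+ q.-1) ^+ q - x * t ^+ q.-1) by ring.
rewrite !frobB_mul -rmorphXn -rmorphB; set u := e _.
set w' := (z ^+ q * _ - z); set u' := (x ^+ q * _ - x).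
have [c ->] := exprD_mod u u' (t ^+ q.-1) q.-1.
have -> : 1 + (u ^+ q.-1 + t ^+ q.-1 * c) = t ^+ q.-1 * c.
  by rewrite addrA /u -rmorphXn -(rmorph1 e) -rmorphD w0 rmorph0 add0r.
rewrite [X in X - _ * _]exprSq mulrC -mulrBl.
set v := _ ^+ _ - (_ + _).
exists ((v * w') ^+ q.-1 - c ^+ q).
by rewrite (mulrCA v) !exprMn -!exprM (mulnC q.-1 q) -mulrBr.
Qed.

(** This and the next three lemmas give the exact orders along the vertical and horizontal lines, so
    that both pure terms of the form of lowest weight are nonzero. Here w^q changes by (t^q - t)^q,
    of order q. *)
Lemma fexp_vert1 (zeta : K) : (zeta ^+ q - zeta) ^+ (q * q.-1) = 1 ->
  exists2 g : {poly K}, fexp (cK K 0) (cK K zeta + 'X) = 'X^q * g & g.[0] != 0.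
Proof.
move=> w0; rewrite /fexp rmorph0 expr0q subrr.
rewrite expr0q1 mul0r subr0 addr0 expr1n (frobD (cK K) (cK K zeta)).
have -> : cK K zeta ^+ q + 'X^q - (cK K zeta + 'X) = cK K (zeta ^+ q - zeta) + ('X^q - 'X).
  rewrite rmorphB rmorphXn; ring.
rewrite [X in X ^+ q.-1](frobD (cK K)) -rmorphXn.
rewrite [X in X - 'X]exprSq -[X in _ - X]mulr1 -mulrBr exprMn.
set a := (zeta ^+ q - zeta) ^+ q; set y := 'X^_ - 1.
(* With 1 written as [a ^+ q.-1] this is a difference of (q-1)-th powers, whose cofactor at t = 0 is
   [- a ^+ q.-2]. *)
have -> : 1 = (cK K a) ^+ q.-1 by rewrite -rmorphXn -exprM w0 rmorph1.
rewrite subrXX [_ + _ - _]addrC addKr -mulrA.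
eexists; first by reflexivity.
have a0 : a != 0.
  apply: contra_eq_neq w0 => a0; rewrite exprM -/a a0 expr0q1 eq_sym oner_neq0 //.
rewrite hornerM mulf_neq0 //.
  by rewrite /y horner_exp !hornerE expr0q1 sub0r expf_neq0 ?oppr_eq0 ?oner_neq0.
rewrite horner_sum (eq_bigr (fun=> a ^+ q.-2)) => [|i _].
  by rewrite sumr_const card_ord -mulr_natl pred_q_natr mulN1r oppr_eq0 expf_neq0.
rewrite !(hornerM, horner_exp, hornerD, hornerC, hornerX) expr0q mul0r addr0.
rewrite -exprD; congr (_ ^+ _); have := ltn_ord i; clear; lia.
Qed.

Lemma fexp_hor1 (zeta : K) : (zeta ^+ q - zeta) ^+ (q * q.-1) = 1 ->
  exists2 g : {poly K}, fexp (cK K 0 + 'X) (cK K zeta) = 'X^(q.-1) * g & g.[0] != 0.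
Proof.
move=> w0; rewrite /fexp rmorph0 add0r -rmorphXn -rmorphB.
rewrite [X in X - 'X]exprSq -[X in _ - X]mulr1 -mulrBr exprMn.
set y := ('X^_ - 1) ^+ _; set w := zeta ^+ q - zeta.
have w00 : w != 0.
  by apply: contra_eq_neq w0 => w00; rewrite -/w w00 exprM expr0q expr0q1 eq_sym oner_neq0.
rewrite [(1 + _) ^+ q](frobD (cK K)) expr1n.
have e1 : 1 = (cK K (w ^+ q)) ^+ q.-1 by rewrite -rmorphXn -exprM w0 rmorph1.
rewrite e1 opprD addrA subrXX -rmorphXn [_ - _ - _]addrC addKr.
set S := \sum_(_ < _) _.
(* The term coming from Q^q has order q(q-1), so the order q - 1 is decided by the other term. *)
rewrite [('X^_ * y) ^+ q]exprSq mulNr -!mulrA -opprD -mulrDr -mulrN.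
eexists; first by reflexivity.
rewrite !(hornerM, horner_exp, hornerD, hornerN, hornerC, hornerX) /S horner_sum expr0q1.
rewrite (eq_bigr (fun=> (w ^+ q) ^+ q.-2)) => [|i _].
  rewrite sumr_const card_ord -mulr_natl pred_q_natr !mul0r expr0q1 mulr0 addr0 sub0r.
  by rewrite mulN1r !mulrN opprK !mulf_neq0 ?expf_neq0 ?oppr_eq0 ?oner_neq0.
rewrite !(hornerM, horner_exp, hornerD, hornerN, hornerC, hornerX) expr0q1 !mul0r subr0.
rewrite -exprD; congr (_ ^+ _); have := ltn_ord i; clear; lia.
Qed.

Lemma fexp_vert2 (om : K) : 1 + (om ^+ q - om) ^+ q.-1 = 0 ->
  exists2 g : {poly K}, fexp (cK K om) (cK K 0 + 'X) = 'X^(q.-1) * g & g.[0] != 0.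
Proof.
move=> w0; rewrite /fexp rmorph0 add0r -!rmorphXn -rmorphB -rmorphXn -(rmorph1 (cK K)) -rmorphD w0.
rewrite rmorph0 expr0q subr0.
have -> : (om ^+ q - om) ^+ q.-1 = -1 by apply/eqP; rewrite -addr_eq0 addrC w0.
rewrite rmorphN rmorph1 mulN1r opprK.
set w := 'X^q - 'X.
have ew : w = 'X * ('X^(q.-1) - 1) by rewrite /w exprSq mulrBr mulr1.
have -> : w ^+ q + w = 'X * (('X^(q.-1) - 1) * (w ^+ q.-1 + 1)).
  by rewrite [w ^+ q]exprSq -[X in _ + X]mulr1 -mulrDr {1}ew mulrA.
rewrite exprMn /w.
eexists; first by reflexivity.
rewrite !(hornerM, horner_exp, hornerD, hornerN, hornerC, hornerX) expr0q1 !expr0q.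
rewrite subrr expr0q1 sub0r add0r mulr1.
by rewrite expf_neq0 // oppr_eq0 oner_neq0.
Qed.

(** On z = 0 the equation is - Q(x,1)^q, and [om] is a simple root of Q(x,1). *)
Lemma fexp_hor2 (om : K) : 1 + (om ^+ q - om) ^+ q.-1 = 0 ->
  exists2 g : {poly K}, fexp (cK K om + 'X) (cK K 0) = 'X^q * g & g.[0] != 0.
Proof.
move=> w0; rewrite /fexp rmorph0.
rewrite expr0q subrr mulr0 expr0q subr0 expr0q1 sub0r.
rewrite (frobD (cK K) (cK K om)).
have -> : cK K om ^+ q + 'X^q - (cK K om + 'X) = cK K (om ^+ q - om) + ('X^q - 'X).
  rewrite rmorphB rmorphXn; ring.
set u := om ^+ q - om.
have u0 : u != 0.
  by apply: contra_eq_neq w0 => u0; rewrite -/u u0 expr0q1 addr0 oner_neq0.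
have -> : 1 = - (cK K u) ^+ q.-1.
  by apply/eqP; rewrite -addr_eq0 -rmorphXn -(rmorph1 (cK K)) -rmorphD w0 rmorph0.
rewrite addrC subrXX [_ + _ - _]addrC addKr.
rewrite [X in X - 'X]exprSq -[X in _ - X]mulr1 -mulrBr -mulrA exprMn -mulrN.
eexists; first by reflexivity.
rewrite !(hornerM, horner_exp, hornerD, hornerN, hornerC, hornerX) horner_sum expr0q1.
rewrite (eq_bigr (fun=> u ^+ q.-2)) => [|i _].
  rewrite sumr_const card_ord -mulr_natl pred_q_natr sub0r.
  by rewrite oppr_eq0 expf_neq0 // !mulf_neq0 ?oppr_eq0 ?oner_neq0 ?expf_neq0.
rewrite !(hornerM, horner_exp, hornerD, hornerC, hornerX) mul0r addr0.
rewrite -exprD; congr (_ ^+ _); have := ltn_ord i; clear; lia.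
Qed.

(** * The subfield F_q and the orbits of its affine maps *)

Lemma Fq_enum : exists s : seq K, [/\ uniq s, size s = q & forall x, (x \in s) = (x ^+ q == x)].
Proof.
pose P : {poly K} := 'X^q - 'X.
have sP : size P = q.+1.
  by rewrite size_polyDl size_polyXn // size_polyN size_polyX ltnS q_gt1.
have mP : lead_coef P = 1.
  by rewrite lead_coefDl ?lead_coefXn // size_polyN size_polyX size_polyXn ltnS q_gt1.
have [s] := closed_field_poly_normal P; rewrite mP scale1r => Ps.
have q0 : q%:R = 0 :> {poly K}.
  by rewrite -polyC_natr natrX (pcharf0 chK) expr0n; case: k k_gt0.
exists s; split.
(* The derivative of ['X^q - 'X] is -1, so the roots are simple. *)
- rewrite -separable_prod_XsubC -Ps separable_poly.unlock.
  rewrite derivB derivXn derivX -mulr_natl q0 mul0r sub0r.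
  by rewrite -scaleN1r coprimepZr ?oppr_eq0 ?oner_neq0 // coprimep1.
- by apply/eq_add_S; rewrite -sP Ps size_prod_XsubC.
- move=> x; rewrite -root_prod_XsubC -Ps /root !hornerE subr_eq0 //.
Qed.

Lemma Fq0 : (0 : K) ^+ q = 0.
Proof. exact: expr0q. Qed.

Lemma FqB (a b : K) : a ^+ q = a -> b ^+ q = b -> (a - b) ^+ q = a - b.
Proof. by move=> ha hb; rewrite (frobB (idK K)) ha hb. Qed.

Lemma Fq_div (a b : K) : a ^+ q = a -> b ^+ q = b -> (a / b) ^+ q = a / b.
Proof. by move=> ha hb; rewrite exprMn exprVn ha hb. Qed.

Lemma Fq_span_free (x0 a b a' b' : K) : x0 ^+ q != x0 ->
  a ^+ q = a -> b ^+ q = b -> a' ^+ q = a' -> b' ^+ q = b' ->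
  a * x0 + b = a' * x0 + b' -> a = a' /\ b = b'.
Proof.
move=> hx ha hb ha' hb' e.
have [ea|na] := eqVneq a a'; first by split => //; move: e; rewrite ea => /addrI.
case/negP: hx; have na' : a - a' != 0 by rewrite subr_eq0.
have -> : x0 = (b' - b) / (a - a').
  apply: (canRL (mulfK na')); rewrite mulrC mulrBl.
  by apply/eqP; rewrite subr_eq addrAC eq_sym subr_eq e addrC.
by apply/eqP; apply: Fq_div; apply: FqB.
Qed.

(* [g - g(z0)] vanishes on the orbit of [z0], which is regular for general [z0]. *)
Lemma size_affine_invariant (x0 : K) (g : {poly K}) : x0 ^+ q != x0 ->
  (forall a b z, a ^+ q = a -> b ^+ q = b -> g.[z + (a * x0 + b)] = g.[z]) ->
  (forall c z, c != 0 -> c ^+ q = c -> g.[c * z] = g.[z]) ->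
  (1 < size g)%N -> (q ^ 2 * q.-1 < size g)%N.
Proof.
move=> hx trans scal sg; have [s [us ss sP]] := Fq_enum.
have sE x : x \in s -> x ^+ q = x by rewrite sP => /eqP.
pose T := [seq a * x0 + b | a <- s, b <- s].
have TP y : reflect (exists a b, [/\ a ^+ q = a, b ^+ q = b & y = a * x0 + b]) (y \in T).
  apply: (iffP allpairsP) => [[[a b] /= [ha hb ->]]|[a [b [ha hb ->]]]].
    by exists a, b; rewrite !sE.
  by exists (a, b); split; rewrite //= sP ?ha ?hb.
have uT : uniq T.
  apply: allpairs_uniq => // -[a b] [a' b'].
  move=> /allpairsP [[c d] /= [hc hd [-> ->]]] /allpairsP [[c' d'] /= [hc' hd' [-> ->]]] /= e.
  by have [-> ->] := Fq_span_free hx (sE _ hc) (sE _ hd) (sE _ hc') (sE _ hd') e.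
(* Outside [T] the maps z -> cz + l with l in [T] take distinct values at z0: an equality with two
   different c would express z0 as an element of [T]. *)
have [z0 hz0] : exists z0, z0 \notin T.
  have [|z0 hz0] := @closed_field_nonroot K (\prod_(t <- T) ('X - t%:P)).
    by rewrite monic_neq0 ?monic_prod_XsubC.
  by exists z0; rewrite -root_prod_XsubC.
pose S := [seq c * z0 + l | c <- rem 0 s, l <- T].
have s'E c : c \in rem 0 s -> c != 0 /\ c ^+ q = c.
  by rewrite mem_rem_uniq // inE => /andP[c0 /sE].
have uS : uniq S.
  apply: allpairs_uniq => //; first exact: rem_uniq.
  move=> [c l] [c' l'] /allpairsP [[d m] /= [hd /TP[a [b [ha hb em]]] [-> ->]]].
  move=> /allpairsP [[d' m'] /= [hd' /TP[a' [b' [ha' hb' em']]] [-> ->]]] /= e.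
  have [_ dq] := s'E _ hd; have [_ dq'] := s'E _ hd'.
  have [ed|nd] := eqVneq d d'; first by move: e; rewrite ed => /addrI ->.
  case/negP: hz0; apply/TP; have nd' : d - d' != 0 by rewrite subr_eq0.
  exists ((a' - a) / (d - d')), ((b' - b) / (d - d')).
  split; try by apply: Fq_div; apply: FqB.
  have -> : z0 = (m' - m) / (d - d').
    apply: (canRL (mulfK nd')).
    have -> : m' = d * z0 + m - d' * z0 by rewrite e; ring.
    ring.
  by rewrite em em'; ring.
have gz0 : g - g.[z0]%:P != 0.
  by apply: contraTneq sg => /subr0_eq ->; rewrite size_polyC -leqNgt leq_b1.
have rS : all (root (g - g.[z0]%:P)) S.
  apply/allP => y /allpairsP [[c l] /= [/s'E [c0 hc] /TP[a [b [ha hb ->]]] ->]].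
  by rewrite /root hornerD hornerN hornerC trans // scal // subrr.
have := max_poly_roots gz0 rS uS.
rewrite size_allpairs size_rem ?sP ?Fq0 // size_allpairs ss mulnC.
move=> /leq_trans; apply; rewrite (leq_trans (size_polyD _ _)) // geq_max leqnn.
by rewrite size_polyN size_polyC (leq_trans (leq_b1 _)) // ltnW.
Qed.

(** * Symmetries and degree of the curve in the chart *)

Lemma q1_gt0 : (0 < q.-1)%N.
Proof. by rewrite -ltnS prednK ?q_gt1 // q_gt0. Qed.

(** The translation turns w into w + au, and the contribution of au to w^q - u^(q-1) w is a(u^q -
    u^(q-1) u) = 0. *)
Lemma fexp_translate (E : comNzRingType) (e : {rmorphism K -> E}) (x z : E) (a b : K) :
  a ^+ q = a -> b ^+ q = b -> fexp x (z + (e a * x + e b)) = fexp x z.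
Proof.
move=> ha hb; rewrite /fexp (frobD e z) (frobD e (e a * x)) (exprMn _ (e a)) -(rmorphXn e q a) -(rmorphXn e q b) ha hb.
set u := x ^+ q - x; set w := z ^+ q - z.
have -> : z ^+ q + (e a * x ^+ q + e b) - (z + (e a * x + e b)) = w + e a * u.
  by rewrite /w /u; ring.
rewrite (frobD e w) (exprMn _ (e a)) -(rmorphXn e q a) ha (exprSq u).
by congr (_ ^+ _ - _); ring.
Qed.

Lemma fexp_scale (E : comNzRingType) (e : {rmorphism K -> E}) (x z : E) (c : K) :
  c != 0 -> c ^+ q = c -> fexp x (e c * z) = fexp x z.
Proof.
move=> c0 hc; rewrite /fexp exprMn -rmorphXn hc -mulrBr exprMn -rmorphXn hc.
rewrite [_ ^+ q.-1 * (_ * _)]mulrCA -mulrBr exprMn -rmorphXn.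
have -> : c ^+ q.-1 = 1 by apply: (mulfI c0); rewrite -exprSq hc mulr1.
by rewrite rmorph1 mul1r.
Qed.

Lemma fexp_shift (E : comNzRingType) (e : {rmorphism K -> E}) (x z : E) :
  fexp (x + 1) z = fexp x z.
Proof.
rewrite /fexp (frobD e x 1) expr1n.
by have -> : x ^+ q + 1 - (x + 1) = x ^+ q - x by ring.
Qed.

Definition fchart : {poly {poly K}} := fexp ('X : {poly K})%:P 'X.

Lemma ev2_fchart (E : comNzRingType) (e : {rmorphism K -> E}) (x z : E) :
  ev2 e x z fchart = fexp x z.
Proof. by rewrite rmorph_fexp ev2Z ev2C ev1X. Qed.

(** As Q does not involve z, the degree in z and the leading coefficient of the curve are those of
    V^(q-1). *)
Lemma fchart_split : exists2 V : {poly {poly K}}, V \is monic /\ size V = (q ^ 2).+1 &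
  exists Q : {poly K}, fchart = V ^+ q.-1 - (Q ^+ q)%:P.
Proof.
pose u : {poly K} := 'X^q - 'X.
pose V : {poly {poly K}} := ('X^q - 'X) ^+ q - u%:P ^+ q.-1 * ('X^q - 'X).
have q2 : (q < q * q)%N by rewrite -{1}[q]mul1n ltn_pmul2r ?q_gt0 // q_gt1.
pose W : {poly {poly K}} := 'X^q + u%:P ^+ q.-1 * ('X^q - 'X).
have VW : V = 'X^(q * q) - W.
  by rewrite /V /W (frobB (ccK K)) -exprM; ring.
have sW : (size W < (q * q).+1)%N.
  have h (n : nat) : (n <= q)%N -> (size ('X^n : {poly {poly K}}) <= q * q)%N.
    by move=> lnq; rewrite size_polyXn (leq_trans _ q2).
  rewrite ltnS (leq_trans (size_polyD _ _)) // geq_max h //=.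
  rewrite -rmorphXn mul_polyC (leq_trans (size_scale_leq _ _)) //.
  by rewrite (leq_trans (size_polyD _ _)) // geq_max h //= size_polyN -['X]expr1 h // q_gt0.
exists V.
  split; first by rewrite monicE VW lead_coefDl ?lead_coefXn // size_polyN size_polyXn.
  by rewrite VW size_polyDl ?size_polyN size_polyXn // mulnn.
exists (1 + u ^+ q.-1).
rewrite /fchart /fexp; congr (_ ^+ _ - _).
  by rewrite /V rmorphB rmorphXn.
by rewrite rmorphXn rmorphD rmorph1 rmorphXn rmorphB rmorphXn.
Qed.

Lemma size_fchart : size fchart = (q ^ 2 * q.-1).+1.
Proof.
have [V [mV sV] [Q ->]] := fchart_split.
have s : size (V ^+ q.-1) = (q ^ 2 * q.-1).+1.
  by have := size_exp V q.-1; rewrite sV /= => <-; rewrite prednK // size_poly_gt0 monic_neq0 // monic_exp.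
rewrite size_polyDl s // size_polyN (leq_ltn_trans (size_polyC_leq1 _)) // ltnS muln_gt0 q1_gt0.
by rewrite expn_gt0 q_gt0.
Qed.

Lemma fchart_monic : fchart \is monic.
Proof.
have [V [mV sV] [Q fE]] := fchart_split.
have s : size (V ^+ q.-1) = (q ^ 2 * q.-1).+1.
  by have := size_exp V q.-1; rewrite sV /= => <-; rewrite prednK // size_poly_gt0 monic_neq0 // monic_exp.
rewrite fE monicE lead_coefDl ?(monicP (monic_exp _ mV)) //.
rewrite size_polyN s (leq_ltn_trans (size_polyC_leq1 _)) // ltnS muln_gt0 q1_gt0.
by rewrite expn_gt0 q_gt0.
Qed.

(** * Points of the curve with a single branch *)

Lemma fchart_branch1 (zeta : K) A B : fchart = A * B ->
  ev2 (idK K) 0 zeta A = 0 -> ev2 (idK K) 0 zeta B = 0 -> False.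
Proof.
move=> fAB A0 B0.
(* The point lies on the curve, whose equation on x = 0 reads w^(q(q-1)) = 1. *)
have w0 : (zeta ^+ q - zeta) ^+ (q * q.-1) = 1.
  have := ev2_fchart (idK K) 0 zeta; rewrite {1}fAB rmorphM A0 mul0r /fexp.
  rewrite expr0q subrr expr0q1 mul0r subr0 addr0 expr1n -exprM => /esym/eqP.
  by rewrite subr_eq0 => /eqP.
have [R eR] := fexp_weight1 (cccK K) ('X : {poly {poly K}})%:P 'X (('X : {poly K})%:P)%:P w0.
have [g eg g0] := fexp_vert1 w0; have [h eh h0] := fexp_hor1 w0.
apply: (local_unibranch (m := q.-1) (n := q) (R := R) (g := g) (h := h) _ _ _ fAB A0 B0);
  rewrite ?ev2_fchart //.
- exact: q1_gt0.
- exact: q_gt0.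
- by rewrite -{2}(prednK q_gt0) coprimenS.
Qed.

(** The weights q - 1 and q of the expansion at (om, 0) are coprime, so two complementary factors
    cannot meet there. *)
Lemma fchart_branch2 (om : K) A B : 1 + (om ^+ q - om) ^+ q.-1 = 0 -> fchart = A * B ->
  ev2 (idK K) om 0 A = 0 -> ev2 (idK K) om 0 B = 0 -> False.
Proof.
move=> w0 fAB A0 B0.
have [R eR] := fexp_weight2 (cccK K) ('X : {poly {poly K}})%:P 'X (('X : {poly K})%:P)%:P w0.
have [g eg g0] := fexp_vert2 w0; have [h eh h0] := fexp_hor2 w0.
apply: (local_unibranch (m := q) (n := q.-1) (R := R) (g := g) (h := h) _ _ _ fAB A0 B0);
  rewrite ?ev2_fchart //.
- exact: q_gt0.
- exact: q1_gt0.
- by rewrite -{1}(prednK q_gt0) coprimeSn.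
Qed.

(** * Invariance of a factor of minimal degree *)

Lemma ev2_comp (x z : K) (A B : {poly {poly K}}) :
  ev2 (idK K) x z (A \Po B) = ev2 (idK K) x (ev2 (idK K) x z B) A.
Proof.
rewrite -[LHS]/((map_poly (ev1 (idK K) x) (A \Po B)).[z]) map_comp_poly horner_comp //.
Qed.

Lemma map_comp_fchart (h : {rmorphism {poly {poly K}} -> {poly {poly K}}}) :
  h fchart = fexp (h ('X : {poly K})%:P) (h 'X).
Proof. by rewrite rmorph_fexp. Qed.

(** A polynomial monic in z keeps its degree when x is specialised, so it has a zero on every
    vertical line. *)
Lemma monic_vanishing_point (x : K) (A : {poly {poly K}}) : A \is monic -> (1 < size A)%N ->
  exists z, ev2 (idK K) x z A = 0.
Proof.
move=> mA sA; pose g := map_poly (ev1 (idK K) x) A.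
have /closed_rootP [z /rootP gz] : size g != 1%N.
  rewrite size_map_poly_id0 ?(monicP mA) ?rmorph1 ?oner_neq0 //.
  by rewrite gtn_eqF.
by exists z.
Qed.

Lemma minimal_factor_comp (h : {rmorphism {poly {poly K}} -> {poly {poly K}}}) A :
  h fchart = fchart -> h A \is monic -> size (h A) = size A ->
  minimal_monic_factor fchart A -> minimal_monic_factor fchart (h A).
Proof.
move=> hf mh sh [[mA sA [B fB]] minA]; split; last by rewrite sh.
by split; rewrite ?sh //; exists (h B); rewrite -rmorphM -fB hf.
Qed.

Definition trans (l : {poly K}) : {rmorphism {poly {poly K}} -> {poly {poly K}}} :=
  comp_poly ('X + l%:P).

(** The map z -> z + ax fixes the points of x = 0, so [A] and its transform share a zero there. If
    they differed, their product would divide the curve, and two complementary factors would meet at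
    a point with a single branch. *)
Lemma minimal_factor_transl A (a : K) : a ^+ q = a -> minimal_monic_factor fchart A ->
  forall x z, ev2 (idK K) x (z + a * x) A = ev2 (idK K) x z A.
Proof.
move=> ha minA x z; pose T := trans (a *: 'X).
have [[mA sA [B fB]] _] := minA.
have TE C y t : ev2 (idK K) y t (T C) = ev2 (idK K) y (t + a * y) C.
  rewrite /T /trans [LHS]ev2_comp rmorphD ev2Z ev2C -mul_polyC rmorphM ev1C ev1X.
  by [].
have sL : size ('X + (a *: 'X)%:P : {poly {poly K}}) = 2%N.
  by rewrite size_XaddC.
have lL : lead_coef ('X + (a *: 'X)%:P : {poly {poly K}}) = 1.
  by rewrite lead_coefXaddC.
have mT : T A \is monic.
  by rewrite monicE lead_coef_comp ?sL // lL expr1n mulr1 (monicP mA).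
have sT : size (T A) = size A by rewrite size_comp_poly2.
have Tf : T fchart = fchart.
  rewrite map_comp_fchart /T /trans /= comp_polyC comp_polyX.
  have := fexp_translate (ccK K) ('X : {poly K})%:P 'X ha (Fq0).
  by rewrite rmorph0 addr0 -mul_polyC rmorphM.
have [TA _] := minimal_factor_comp Tf mT sT minA.
have [eT|[C fC]] := minimal_factor_dichotomy fchart_monic minA TA sT; first by rewrite -TE eT.
have [zeta Az] := monic_vanishing_point 0 mA sA.
have [] := @fchart_branch1 zeta A (T A * C) _ Az; first by rewrite mulrA.
by rewrite rmorphM TE mulr0 addr0 Az mul0r.
Qed.

(* The curve is invariant under x -> x + 1, so the translations by multiples of x yield
   those by multiples of x - 1. *)
Lemma minimal_factor_affine A (a b : K) : a ^+ q = a -> b ^+ q = b ->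
  minimal_monic_factor fchart A ->
  forall x z, ev2 (idK K) x (z + (a * x + b)) A = ev2 (idK K) x z A.
Proof.
move=> ha hb minA x z.
pose S : {rmorphism {poly {poly K}} -> {poly {poly K}}} :=
  map_poly (comp_poly ('X + 1%:P : {poly K})).
have [[mA sA _] _] := minA.
have SE y t : ev2 (idK K) y t (S A) = ev2 (idK K) (y + 1) t A.
  rewrite -[LHS]/((map_poly (ev1 (idK K) y) (S A)).[t]) /S /= -map_poly_comp.
  congr (_.[_]); apply: eq_map_poly => c /=.
  rewrite /horner_eval map_comp_poly horner_comp; congr (_.[_]).
  by rewrite rmorphD /= map_polyX map_polyC hornerD hornerX hornerC.
have sS : size (S A) = size A.
  by rewrite size_map_poly_id0 // (monicP mA) rmorph1 oner_neq0.
have mS : S A \is monic by rewrite monic_map.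
have Sf : S fchart = fchart.
  rewrite map_comp_fchart /S /= map_polyX map_polyC /= comp_polyX.
  have := fexp_shift (ccK K) ('X : {poly K})%:P ('X : {poly {poly K}}).
  by rewrite rmorphD rmorph1 => ->.
have minS := minimal_factor_comp Sf mS sS minA.
have inv1 y t : ev2 (idK K) y (t + b * (y - 1)) A = ev2 (idK K) y t A.
  by have := minimal_factor_transl hb minS (y - 1) t; rewrite !SE subrK.
(* The constant b is bx - b(x - 1), a sum of translations that are already known to preserve [A]. *)
have -> : z + (a * x + b) = z + b * x + a * x + (- b) * (x - 1) by ring.
have hbN : (- b) ^+ q = - b by have := FqB Fq0 hb; rewrite sub0r.
have inv2 y t : ev2 (idK K) y (t + - b * (y - 1)) A = ev2 (idK K) y t A.
  by have := minimal_factor_transl hbN minS (y - 1) t; rewrite !SE subrK.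
by rewrite inv2 !minimal_factor_transl.
Qed.

Lemma Q_root_exists : exists om : K, 1 + (om ^+ q - om) ^+ q.-1 = 0.
Proof.
have /closed_rootP [u /rootP] : size ('X^(q.-1) + 1%:P : {poly K}) != 1%N.
  by rewrite size_XnaddC ?q1_gt0 // eqSS -lt0n q1_gt0.
rewrite hornerD hornerXn hornerC => hu.
have /closed_rootP [om /rootP] : size ('X^q - ('X + u%:P) : {poly K}) != 1%N.
  rewrite size_polyDl; rewrite size_polyXn; first by rewrite eqSS -lt0n q_gt0.
  by rewrite size_polyN size_XaddC ltnS q_gt1.
rewrite !hornerE => /eqP; rewrite subr_eq0 => /eqP e; exists om.
by rewrite e [om + u]addrC addrK addrC.
Qed.

(** The map z -> cz fixes the points of z = 0. A zero of [A] above a root [om] of Q can be moved to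
    z = 0 by the translations, and there the curve has a single branch. The factor
    [c ^+ (size A).-1] is the leading coefficient of the transform. *)
Lemma minimal_factor_scale A (c : K) : c != 0 -> c ^+ q = c -> minimal_monic_factor fchart A ->
  forall x z, ev2 (idK K) x (c * z) A = c ^+ (size A).-1 * ev2 (idK K) x z A.
Proof.
move=> c0 hc minA x z; have [om w0] := Q_root_exists.
have [[mA sA [B fB]] _] := minA.
pose T : {rmorphism {poly {poly K}} -> {poly {poly K}}} := comp_poly (ccK K c * 'X).
have TE C y t : ev2 (idK K) y t (T C) = ev2 (idK K) y (c * t) C.
  by rewrite /T [LHS]ev2_comp rmorphM ev2Z ev2C ev1C.
have cc0 : ccK K c != 0 by rewrite !polyC_eq0.
have sL : size (ccK K c * 'X) = 2%N by rewrite size_Cmul ?polyC_eq0 // size_polyX.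
have lL : lead_coef (ccK K c * 'X) = c%:P by rewrite lead_coefM lead_coefX mulr1 lead_coefC.
have sT : size (T A) = size A by rewrite size_comp_poly2.
have lT : lead_coef (T A) = (c ^+ (size A).-1)%:P.
  by rewrite lead_coef_comp ?sL // lL (monicP mA) mul1r -rmorphXn.
have cr0 : c ^+ (size A).-1 != 0 by rewrite expf_neq0.
have Tf : T fchart = fchart.
  rewrite map_comp_fchart /T /= comp_polyC comp_polyX.
  exact: (fexp_scale (ccK K)).
pose TA := ccK K (c ^+ (size A).-1)^-1 * T A.
have mTA : TA \is monic.
  by rewrite monicE lead_coefM lead_coefC lT -rmorphM mulVf.
have sTA : size TA = size A by rewrite size_Cmul ?polyC_eq0 ?invr_eq0.
have pTA : proper_monic_factor fchart TA.
  split; rewrite ?sTA //; exists (ccK K (c ^+ (size A).-1) * T B).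
  by rewrite mulrACA -rmorphM mulVf // rmorph1 mul1r -rmorphM -fB Tf.
have [eT|[C fC]] := minimal_factor_dichotomy fchart_monic minA pTA sTA.
  have TAE : T A = ccK K (c ^+ (size A).-1) * A.
    transitivity (ccK K (c ^+ (size A).-1) * TA); last by rewrite eT.
    by rewrite /TA mulrA -rmorphM mulfV // rmorph1 mul1r.
  by rewrite -TE TAE rmorphM ev2C ev1C.
have [zeta Az] := monic_vanishing_point om mA sA.
have A0 : ev2 (idK K) om 0 A = 0.
  set u := om ^+ q - om in w0 *; set w := zeta ^+ q - zeta.
  have u0 : u != 0.
    by apply: contra_eq_neq w0 => ->; rewrite expr0q1 addr0 oner_neq0.
  have uE : u ^+ q.-1 = -1 by apply/eqP; rewrite -addr_eq0 addrC w0.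
  have V0 : w ^+ q + w = 0.
    have := ev2_fchart (idK K) om zeta; rewrite {1}fB rmorphM Az mul0r /fexp -/u -/w.
    rewrite w0 expr0q subr0 uE mulN1r opprK => /esym/eqP.
    by rewrite expf_eq0 => /andP[_ /eqP].
  (* From u^q = -u and w^q = -w the quotient a = w/u lies in F_q, hence so does b = zeta - a om. So
     zeta = a om + b is a translate of 0. *)
  have ha : (w / u) ^+ q = w / u.
    rewrite exprMn exprVn (exprSq u) uE mulrN1 invrN mulrN.
    have -> : w ^+ q = - w by apply/eqP; rewrite -addr_eq0 V0.
    by rewrite mulNr opprK.
  set a := w / u in ha; pose b := zeta - a * om.
  have hb : b ^+ q = b.
    apply/eqP; rewrite -subr_eq0 /b (frobB (idK K)) exprMn ha.
    have -> : zeta ^+ q - a * om ^+ q - (zeta - a * om) = w - a * u by rewrite /w /u; ring.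
    by rewrite /a divfK // subrr.
  have := minimal_factor_affine ha hb minA om 0.
  by rewrite add0r /b addrC subrK Az.
have [] := @fchart_branch2 om A (TA * C) w0 _ A0; first by rewrite mulrA.
by rewrite rmorphM rmorphM TE mulr0 A0 mulr0 mul0r.
Qed.

(** Above a point x0 outside F_q with Q(x0,1) nonzero, [A] does not vanish at z = 0, so comparing
    values there shows that its scaling factors are 1. The specialised polynomial is then constant
    on orbits of size q^2 (q-1). *)
Lemma minimal_factor_size A : minimal_monic_factor fchart A -> size A = size fchart.
Proof.
move=> minA; have [[mA sA [B fB]] _] := minA.
pose u : {poly K} := 'X^q - 'X.
have [x0] : exists x0, (u * (1 + u ^+ q.-1)).[x0] != 0.
  apply: closed_field_nonroot; have u_gt1 : (1 < size u)%N.
    by rewrite size_polyDl size_polyXn ?size_polyN ?size_polyX ltnS ?q_gt0 ?q_gt1.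
  have u0 : u != 0 by rewrite -size_poly_gt0 ltnW.
  rewrite mulf_neq0 //; have : (1 + u ^+ q.-1).[0] != 0.
    by rewrite !hornerE expr0q subrr expr0q1 addr0 oner_neq0.
  by apply: contraNneq => ->; rewrite horner0.
rewrite !hornerE mulf_eq0 negb_or subr_eq0 => /andP[hx Q0].
pose g := map_poly (ev1 (idK K) x0) A.
have gE z : g.[z] = ev2 (idK K) x0 z A by [].
have sg : size g = size A.
  by rewrite size_map_poly_id0 // (monicP mA) rmorph1 oner_neq0.
have g0 : g.[0] != 0.
  have : ev2 (idK K) x0 0 fchart != 0.
    rewrite ev2_fchart /fexp expr0q subrr expr0q mulr0 subr0 expr0q1 sub0r oppr_eq0.
    by rewrite expf_neq0.
  by rewrite gE fB rmorphM mulf_eq0 negb_or => /andP[].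
apply/eqP; rewrite eqn_leq size_fchart -{2}sg; apply/andP; split.
  have := monic_neq0 fchart_monic; rewrite {1}fB mulf_eq0 negb_or => /andP[A0 B0].
  rewrite -size_fchart fB size_mul // -subn1 -addnBA ?leq_addr // size_poly_gt0.
  exact: B0.
apply: (size_affine_invariant hx).
- by move=> a b z ha hb; rewrite !gE minimal_factor_affine.
- move=> c z c0 hc; rewrite !gE (minimal_factor_scale c0 hc minA).
  have := minimal_factor_scale c0 hc minA x0 0.
  rewrite mulr0 -gE -[LHS]mul1r => /(mulIf g0) <-.
  by rewrite mul1r.
- by rewrite sg.
Qed.

Lemma fchart_irreducible (G H : {poly {poly K}}) :
  fchart = G * H -> (size G <= 1)%N \/ (size H <= 1)%N.
Proof. exact: (proper_factors_trivial fchart_monic minimal_factor_size). Qed.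

End Dickson.

(** * Ternary forms and linear substitutions *)

Definition i0 : 'I_3 := @Ordinal 3 0 isT.
Definition i1 : 'I_3 := @Ordinal 3 1 isT.
Definition i2 : 'I_3 := @Ordinal 3 2 isT.

Lemma ord3P (P : 'I_3 -> Prop) : P i0 -> P i1 -> P i2 -> forall i, P i.
Proof.
by move=> h0 h1 h2 [[|[|[|i]]] hi] //; [move: h0|move: h1|move: h2]; congr P; apply: val_inj.
Qed.

Lemma big_ord3 (R : Type) (idx : R) (op : Monoid.law idx) (F : 'I_3 -> R) :
  \big[op/idx]_(i < 3) F i = op (F i0) (op (F i1) (F i2)).
Proof.
rewrite !big_ord_recl big_ord0 Monoid.mulm1.
by congr (op (F _) (op (F _) (F _))); apply: val_inj.
Qed.

Lemma mdeg3 (m : 'X_{1..3}) : mdeg m = (m i0 + (m i1 + m i2))%N.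
Proof. by rewrite mdegE big_ord3. Qed.

Section TernaryForms.
Variable K : fieldType.
Implicit Types (F G H : {mpoly K[3]}) (A B M N : 'M[K]_3).

Lemma mpolyX3 (m : 'X_{1..3}) : 'X_[m] = 'X_i0 ^+ m i0 * ('X_i1 ^+ m i1 * 'X_i2 ^+ m i2) :> {mpoly K[3]}.
Proof. by rewrite mpolyXE_id big_ord3. Qed.

Lemma mpoly_rmorph_eq (E : comNzRingType) (f g : {rmorphism {mpoly K[3]} -> E}) F :
  (forall c, f c%:MP = g c%:MP) -> f 'X_i0 = g 'X_i0 -> f 'X_i1 = g 'X_i1 ->
  f 'X_i2 = g 'X_i2 -> f F = g F.
Proof.
move=> hC h0 h1 h2; rewrite (mpolyE F) !rmorph_sum; apply: eq_bigr => m _.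
by rewrite -mul_mpolyC mpolyX3 !rmorphM !rmorphXn hC h0 h1 h2.
Qed.

Lemma dhomog_mdeg d F m : F \is [in K[3], d.-homog] -> m \in msupp F -> mdeg m = d.
Proof. by move=> /dhomogP h /h. Qed.

Lemma msize_dhomog_le d F : F \is [in K[3], d.-homog] -> (msize F <= d.+1)%N.
Proof.
move=> hF; rewrite msizeE; apply/bigmax_leqP_seq => m hm _.
by rewrite (dhomog_mdeg hF hm).
Qed.

Lemma msize_dhomog d F : F \is [in K[3], d.-homog] -> F != 0 -> msize F = d.+1.
Proof.
move=> hF F0; apply/eqP; rewrite eqn_leq msize_dhomog_le //=.
have : (msize F != 0)%N by rewrite msize_poly_eq0.
case E : (msupp F) => [|m s]; first by rewrite (msuppnil0 E) eqxx in F0.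
by have hm : m \in msupp F; [rewrite E mem_head|rewrite -(dhomog_mdeg hF hm) msize_mdeg_lt].
Qed.

Lemma irreducible_no_linear_factor d F L G : F \is [in K[3], d.-homog] -> (1 < d)%N ->
  irreducible_mpoly F -> L \is [in K[3], 1.-homog] -> L != 0 -> F = L * G -> False.
Proof.
move=> hF d1 [sF irF] hL L0 FLG.
have F0 : F != 0 by apply: contraTneq sF => ->; rewrite msize0.
have sL := msize_dhomog hL L0; have sFd := msize_dhomog hF F0.
have G0 : G != 0 by apply: contraNneq F0 => G0; rewrite FLG G0 mulr0.
case: (irF _ _ FLG); first by rewrite sL.
by have := msizeM L0 G0; rewrite -FLG sL sFd addSn /= add1n => -[<-]; rewrite leqNgt d1.
Qed.

Lemma mpolyX_dvd (i : 'I_3) F : (forall m, m \in msupp F -> (0 < m i)%N) ->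
  exists G, F = 'X_i * G.
Proof.
move=> h; exists (\sum_(m <- msupp F) F@_m *: 'X_[m - U_(i)]).
rewrite {1}(mpolyE F) mulr_sumr; apply: eq_big_seq => m hm.
rewrite -scalerAr -mpolyXD; congr (_ *: 'X_[_]); apply/mnmP => j.
rewrite mnmDE mnmBE mnm1E; have := h m hm.
by case: eqVneq => [->|_]; case: (m _) => //= n _; rewrite ?subn0 ?add0n // subn1.
Qed.

Lemma lin_substE A i : tnth (lin_subst A) i =
  A i i0 *: 'X_i0 + (A i i1 *: 'X_i1 + A i i2 *: 'X_i2) :> {mpoly K[3]}.
Proof. by rewrite tnth_mktuple big_ord3. Qed.

Lemma lin_substX A i : 'X_i \mPo lin_subst A = tnth (lin_subst A) i.
Proof. by rewrite comp_mpolyXU (tnth_nth 0). Qed.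

Lemma lin_subst_mul A B F : (F \mPo lin_subst A) \mPo lin_subst B = F \mPo lin_subst (A *m B).
Proof.
pose f : {rmorphism {mpoly K[3]} -> {mpoly K[3]}} := comp_mpoly (lin_subst B) \o comp_mpoly (lin_subst A).
have X i : ('X_i \mPo lin_subst A) \mPo lin_subst B = 'X_i \mPo lin_subst (A *m B).
  rewrite !lin_substX !lin_substE !rmorphD /= !comp_mpolyZ !lin_substX !lin_substE !mxE !big_ord3.
  rewrite !scalerDr !scalerA !scalerDl /= -!addrA.
  rewrite -!mul_mpolyC; ring.
apply: (@mpoly_rmorph_eq _ f (comp_mpoly (lin_subst (A *m B)))) => [c|||].
- by rewrite /f /= !comp_mpolyC.
- exact: X.
- exact: X.
- exact: X.
Qed.

Lemma lin_subst1 F : F \mPo lin_subst 1%:M = F.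
Proof.
rewrite -[RHS]comp_mpoly_id; congr (_ \mPo _); apply: eq_from_tnth => i.
rewrite lin_substE tnth_mktuple; move: i; apply: ord3P; rewrite !mxE /=;
by rewrite !scale0r ?scale1r ?addr0 ?add0r.
Qed.

Lemma lin_subst_dhomog d A F : F \is [in K[3], d.-homog] -> F \mPo lin_subst A \is [in K[3], d.-homog].
Proof.
move=> hF; rewrite comp_mpolyE big_seq; apply: rpred_sum => m hm; apply: rpredZ.
rewrite big_ord3 -(dhomog_mdeg hF hm) mdeg3.
have h i : (tnth (lin_subst A) i) ^+ m i \is [in K[3], (m i).-homog].
  rewrite -[X in X.-homog]mul1n; apply: dhomogMn; rewrite lin_substE.
  by rewrite !rpredD // rpredZ // dhomogX /= mdeg1.
by rewrite !dhomogM.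
Qed.

Lemma msize_lin_subst_le1 A F : (msize F <= 1)%N -> (msize (F \mPo lin_subst A) <= 1)%N.
Proof. by move=> /msize1_polyC ->; rewrite comp_mpolyC msizeC; case: eqP. Qed.

Lemma irreducible_lin_subst M N F : M *m N = 1%:M ->
  irreducible_mpoly F -> irreducible_mpoly (F \mPo lin_subst M).
Proof.
move=> MN [sF irF].
have FK G : (G \mPo lin_subst M) \mPo lin_subst N = G by rewrite lin_subst_mul MN lin_subst1.
have FK' G : (G \mPo lin_subst N) \mPo lin_subst M = G.
  by rewrite lin_subst_mul (mulmx1C MN) lin_subst1.
split.
  by rewrite ltnNge; apply: contraTN sF => /(msize_lin_subst_le1 N); rewrite FK -leqNgt.
move=> G H e; have := FK F; rewrite e rmorphM /= => /esym/irF [] /(msize_lin_subst_le1 M).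
  by rewrite FK'; left.
by rewrite FK'; right.
Qed.

End TernaryForms.

(** * Dehomogenization at y = 1 *)

Section Dehomogenization.
Variable K : fieldType.
Implicit Types (F G H : {mpoly K[3]}).

Definition dehom : {rmorphism {mpoly K[3]} -> {poly {poly K}}} :=
  mmap (ccK K) (tnth [tuple ('X : {poly K})%:P; 1; 'X]).

Lemma dehomC c : dehom c%:MP = ccK K c.
Proof. exact: mmapC. Qed.

Lemma dehomX (i : 'I_3) : dehom 'X_i = tnth [tuple ('X : {poly K})%:P; 1; 'X] i.
Proof. by rewrite [LHS]mmapX mmap1U. Qed.

Lemma dehomX0 : dehom 'X_i0 = ('X : {poly K})%:P.
Proof. by rewrite dehomX. Qed.

Lemma dehomX1 : dehom 'X_i1 = 1.
Proof. by rewrite dehomX. Qed.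

Lemma dehomX2 : dehom 'X_i2 = 'X.
Proof. by rewrite dehomX. Qed.

Lemma dehomE F : dehom F = \sum_(m <- msupp F) (F@_m *: 'X^(m i0))%:P * 'X^(m i2).
Proof.
rewrite {1}(mpolyE F) rmorph_sum; apply: eq_bigr => m _.
rewrite -mul_mpolyC mpolyX3 !rmorphM !rmorphXn dehomC dehomX0 dehomX1 dehomX2.
by rewrite expr1n mul1r mulrA -polyC_exp -polyCM [_%:P * 'X^(m i0)]mul_polyC.
Qed.

Lemma size_dehom_le F : (size (dehom F) <= msize F)%N.
Proof.
rewrite dehomE big_seq; apply: (big_ind (fun P : {poly {poly K}} => (size P <= msize F)%N)).
- by rewrite size_poly0.
- by move=> P Q hP hQ; rewrite (leq_trans (size_polyD _ _)) // geq_max hP.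
move=> m hm; rewrite mul_polyC (leq_trans (size_scale_leq _ _)) // size_polyXn.
rewrite (leq_trans _ (msize_mdeg_lt hm)) // ltnS mdeg3.
by rewrite addnA leq_addl.
Qed.

(** In a form of degree d the exponents of x and z determine that of y, so no two monomials are
    merged. *)
Lemma coef_dehom d F m : F \is [in K[3], d.-homog] -> m \in msupp F ->
  (dehom F)`_(m i2)`_(m i0) = F@_m.
Proof.
move=> hF hm; rewrite dehomE !coef_sum (bigD1_seq m) //= big_seq_cond big1 => [|m' /andP[hm' nm]].
  by rewrite coefMXn ltnn subnn coefC eqxx coefZ coefXn eqxx mulr1 addr0.
rewrite coefMXn; case: ltnP => [|le2]; first by rewrite coef0.
rewrite coefC subn_eq0; case: leqP => [ge2|]; last by rewrite coef0.
rewrite coefZ coefXn; case: eqP => [e0|]; last by rewrite mulr0.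
case/negP: nm; apply/eqP/mnmP; apply: ord3P => //; last by apply/eqP; rewrite eqn_leq le2 ge2.
have := dhomog_mdeg hF hm; rewrite -(dhomog_mdeg hF hm') !mdeg3.
by move: e0 le2 ge2; clear; lia.
Qed.

End Dehomogenization.

(** * The curve as a form in Dickson invariants *)

Section Curve.
Variables (p k : nat) (K : closedFieldType).
Hypotheses (pr_p : prime p) (k_gt0 : (0 < k)%N) (chK : p \in [pchar K]).
Local Notation q := (p ^ k)%N.

Section Forms.
Variable E : comNzRingType.

(* L^(q-1) and Q generate the Dickson invariants of GL(2,q); V is the product of all
   z + ax + by with a, b in F_q. *)
Definition Lform (x y : E) := x ^+ q * y - x * y ^+ q.
Definition Qform (x y : E) := \sum_(i < q.+1) (x ^+ q.-1) ^+ (q - i) * (y ^+ q.-1) ^+ i.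
Definition Vform (x y z : E) := z ^+ (q * q) - Qform x y * z ^+ q + Lform x y ^+ q.-1 * z.
Definition Cform (x y z : E) := Vform x y z ^+ q.-1 - Qform x y ^+ q.

(** With a = x^(q-1) and b = y^(q-1), L is xy(a - b) and Q is the geometric sum (a^(q+1) -
    b^(q+1))/(a - b). *)
Lemma Qform_mulL x y : Qform x y * Lform x y = x ^+ (q * q) * y - x * y ^+ (q * q).
Proof.
have sq a : a ^+ (q * q) = a * (a ^+ q.-1) ^+ q.+1 :> E.
  rewrite -exprM -exprS; congr (_ ^+ _).
  by have := q_gt0 pr_p k_gt0; case: (q) => // n _ /=; ring.
have -> : Lform x y = x * y * (x ^+ q.-1 - y ^+ q.-1).
  by rewrite /Lform !(exprSq pr_p k_gt0); ring.
by rewrite mulrCA [Qform x y * _]mulrC -subrXX !sq; ring.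
Qed.

End Forms.

Lemma rmorph_Lform (E E' : comNzRingType) (h : {rmorphism E -> E'}) x y :
  h (Lform x y) = Lform (h x) (h y).
Proof. by rewrite /Lform rmorphB !rmorphM !rmorphXn. Qed.

Lemma rmorph_Qform (E E' : comNzRingType) (h : {rmorphism E -> E'}) x y :
  h (Qform x y) = Qform (h x) (h y).
Proof. by rewrite rmorph_sum; apply: eq_bigr => i _; rewrite rmorphM !rmorphXn. Qed.

Lemma rmorph_Cform (E E' : comNzRingType) (h : {rmorphism E -> E'}) x y z :
  h (Cform x y z) = Cform (h x) (h y) (h z).
Proof.
rewrite /Cform /Vform rmorphB !rmorphXn rmorphD rmorphB !rmorphM !rmorphXn.
by rewrite rmorph_Qform rmorph_Lform.
Qed.

Section Invariance.
Variables (E : idomainType) (e : {rmorphism K -> E}).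

(** Up to sign L is the determinant with rows (x, y) and (x^q, y^q), and coefficients in F_q commute
    with the q-th power. *)
Lemma Lform_linear (a b c d : K) (x y : E) :
  a ^+ q = a -> b ^+ q = b -> c ^+ q = c -> d ^+ q = d ->
  Lform (e a * x + e b * y) (e c * x + e d * y) = e (a * d - b * c) * Lform x y.
Proof.
move=> ha hb hc hd; rewrite /Lform !(frobD k pr_p chK e) !exprMn -!rmorphXn ha hb hc hd.
by rewrite rmorphB !rmorphM; ring.
Qed.

(** Both QL and L are multiplied by the determinant of the substitution; L can be cancelled. *)
Lemma Qform_linear (a b c d : K) (x y : E) : Lform x y != 0 -> a * d - b * c != 0 ->
  a ^+ q = a -> b ^+ q = b -> c ^+ q = c -> d ^+ q = d ->
  Qform (e a * x + e b * y) (e c * x + e d * y) = Qform x y.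
Proof.
move=> L0 det0 ha hb hc hd.
have := Qform_mulL (e a * x + e b * y) (e c * x + e d * y).
rewrite Lform_linear // ![_ ^+ (q * q)]exprM.
rewrite !(frobD k pr_p chK e) !exprMn -!rmorphXn !ha !hb !hc !hd -!exprM => eq1.
have nz : e (a * d - b * c) * Lform x y != 0 by rewrite mulf_neq0 // fmorph_eq0.
apply: (mulIf nz); rewrite eq1 mulrCA Qform_mulL rmorphB !rmorphM; ring.
Qed.

(** Up to sign V(x,y,z) L(x,y) is the Moore determinant of x, y, z, which vanishes when z = x. *)
Lemma Vform_x (x y : E) : Lform x y != 0 -> Vform x y x = 0.
Proof.
move=> L0; apply: (mulIf L0); rewrite mul0r /Vform.
have -> : (x ^+ (q * q) - Qform x y * x ^+ q + Lform x y ^+ q.-1 * x) * Lform x y =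
  x ^+ (q * q) * Lform x y - Qform x y * Lform x y * x ^+ q + Lform x y ^+ q * x.
  by rewrite (exprSq pr_p k_gt0 (Lform x y)); ring.
by rewrite Qform_mulL /Lform (frobB k pr_p chK e) !exprMn -!exprM; ring.
Qed.

Lemma Vform_y (x y : E) : Lform x y != 0 -> Vform x y y = 0.
Proof.
move=> L0; apply: (mulIf L0); rewrite mul0r /Vform.
have -> : (y ^+ (q * q) - Qform x y * y ^+ q + Lform x y ^+ q.-1 * y) * Lform x y =
  y ^+ (q * q) * Lform x y - Qform x y * Lform x y * y ^+ q + Lform x y ^+ q * y.
  by rewrite (exprSq pr_p k_gt0 (Lform x y)); ring.
by rewrite Qform_mulL /Lform (frobB k pr_p chK e) !exprMn -!exprM; ring.
Qed.

(** V is F_q-linear in z and has x and y among its roots, so only the term in z survives. *)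
Lemma Vform_additive (x y z : E) (f g h : K) : Lform x y != 0 ->
  f ^+ q = f -> g ^+ q = g -> h ^+ q = h ->
  Vform x y (e f * x + (e g * y + e h * z)) = e h * Vform x y z.
Proof.
move=> L0 hf hg hh.
transitivity (e f * Vform x y x + (e g * Vform x y y + e h * Vform x y z)); last first.
  by rewrite Vform_x // Vform_y // !mulr0 !add0r.
rewrite /Vform !exprM !(frobD k pr_p chK e) !exprMn -!rmorphXn !hf !hg !hh.
by ring.
Qed.

Lemma Fq_unit_expr (c : K) : c != 0 -> c ^+ q = c -> c ^+ q.-1 = 1.
Proof. by move=> c0 hc; apply: (mulfI c0); rewrite -(exprSq pr_p k_gt0) hc mulr1. Qed.

(** Q and L^(q-1) are unchanged, so V is only multiplied by h, and h^(q-1) = 1. *)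
Lemma Cform_invariant (a b c d f g h : K) (x y z : E) : Lform x y != 0 ->
  a * d - b * c != 0 -> h != 0 ->
  a ^+ q = a -> b ^+ q = b -> c ^+ q = c -> d ^+ q = d ->
  f ^+ q = f -> g ^+ q = g -> h ^+ q = h ->
  Cform (e a * x + e b * y) (e c * x + e d * y) (e f * x + (e g * y + e h * z)) = Cform x y z.
Proof.
move=> L0 det0 h0 ha hb hc hd hf hg hh.
have hdet : (a * d - b * c) ^+ q = a * d - b * c.
  by rewrite (frobB k pr_p chK (idK K)) !exprMn ha hb hc hd.
rewrite /Cform Qform_linear //; congr (_ - _).
have -> t : Vform (e a * x + e b * y) (e c * x + e d * y) t = Vform x y t.
  by rewrite /Vform Qform_linear // Lform_linear // exprMn -rmorphXn Fq_unit_expr // rmorph1 mul1r.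
by rewrite Vform_additive // exprMn -rmorphXn Fq_unit_expr // rmorph1 mul1r.
Qed.

End Invariance.

Definition curve : {mpoly K[3]} := Cform 'X_i0 'X_i1 'X_i2.

Lemma Lform_neq0 : Lform ('X : {poly K})%:P 1 != 0 :> {poly {poly K}}.
Proof.
rewrite /Lform expr1n !mulr1 -rmorphXn -rmorphB polyC_eq0 -size_poly_eq0.
by rewrite size_polyDl size_polyXn // size_polyN size_polyX ltnS q_gt1.
Qed.

Lemma dehom_curve : dehom K curve = fchart p k K.
Proof.
rewrite /curve rmorph_Cform dehomX0 dehomX1 dehomX2 /fchart /fexp.
set x := ('X : {poly K})%:P; set z := 'X.
have LE : Lform x 1 = x ^+ q - x by rewrite /Lform expr1n !mulr1.
(* Multiplied by L(x,1) = x^q - x, both sides become x^(q^2) - x. *)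
have QE : Qform x 1 = 1 + (x ^+ q - x) ^+ q.-1.
  apply: (mulIf Lform_neq0); rewrite Qform_mulL LE expr1n !mulr1 mulrDl mul1r.
  rewrite [_ ^+ q.-1 * _]mulrC -(exprSq pr_p k_gt0) (frobB k pr_p chK (ccK K)) -exprM.
  by ring.
rewrite /Cform /Vform QE LE; congr (_ ^+ _ - _).
by rewrite (frobB k pr_p chK (ccK K)) -exprM; ring.
Qed.

Lemma curve_dhomog : curve \is [in K[3], (q ^ 3 - q ^ 2).-homog].
Proof.
have hX (i : 'I_3) n : ('X_i ^+ n : {mpoly K[3]}) \is [in K[3], n.-homog].
  by rewrite -{2}[n]mul1n; apply: dhomogMn; rewrite dhomogX /= mdeg1.
have [r qr] : exists r, q = r.+1 by exists q.-1; rewrite prednK // q_gt0.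
have hL : Lform 'X_i0 'X_i1 \is [in K[3], (q.+1).-homog].
  rewrite rpredB //.
    by have := dhomogM (hX i0 q) (hX i1 1%N); rewrite expr1 addn1.
  by have := dhomogM (hX i0 1%N) (hX i1 q); rewrite expr1 add1n.
have hQ : Qform 'X_i0 'X_i1 \is [in K[3], (q.-1 * q).-homog].
  apply: rpred_sum => i _; rewrite -!exprM.
  have -> : (q.-1 * q = q.-1 * (q - i) + q.-1 * i)%N.
    by rewrite -mulnDr subnK // -ltnS ltn_ord.
  by apply: dhomogM; exact: hX.
have hV : Vform 'X_i0 'X_i1 'X_i2 \is [in K[3], (q * q).-homog].
  rewrite rpredD ?rpredB //.
  - have -> : (q * q = q.-1 * q + q)%N by rewrite qr /=; ring.
    by apply: dhomogM.
  - have -> : (q * q = q.+1 * q.-1 + 1)%N by rewrite qr /=; ring.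
    by apply: dhomogM; [exact: dhomogMn|have := hX i2 1%N; rewrite expr1].
have -> : (q ^ 3 - q ^ 2 = q * q * q.-1)%N.
  by rewrite expnSr -{2}[(q ^ 2)%N]muln1 -mulnBr subn1 mulnn.
rewrite rpredB //; first exact: dhomogMn.
have -> : (q * q * q.-1 = q.-1 * q * q)%N by ring.
exact: dhomogMn.
Qed.

End Curve.

(** * Irreducibility, invariance and the degree bound for one point *)

Section InvariantCurves.
Variables (p k : nat) (K : closedFieldType).
Hypotheses (pr_p : prime p) (k_gt0 : (0 < k)%N) (chK : p \in [pchar K]).
Local Notation q := (p ^ k)%N.

Definition e2 : 'cV[K]_3 := delta_mx i2 0.

Lemma cube_minus_square : (q ^ 3 - q ^ 2 = q ^ 2 * q.-1)%N.
Proof. by rewrite expnSr -{2}[(q ^ 2)%N]muln1 -mulnBr subn1. Qed.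

(** The degree in z equals the total degree of the form. So a factor of degree 0 in z leaves the
    whole degree to its cofactor and must be constant. *)
Lemma curve_irreducible : irreducible_mpoly (curve p k K).
Proof.
have sf := size_fchart pr_p k_gt0 chK.
have hC := curve_dhomog K pr_p k_gt0.
have C0 : curve p k K != 0.
  apply: contra_eq_neq sf => C0.
  by rewrite -(dehom_curve pr_p k_gt0 chK) C0 rmorph0 size_poly0.
have sC := msize_dhomog hC C0; rewrite cube_minus_square in sC.
split.
  rewrite sC ltnS muln_gt0 expn_gt0 (q_gt0 pr_p k_gt0) /=.
  exact: (q1_gt0 pr_p k_gt0).
move=> G H CGH.
have half (G' H' : {mpoly K[3]}) : curve p k K = G' * H' -> (size (dehom K G') <= 1)%N -> (msize G' <= 1)%N.
  move=> e sG; move: (C0); rewrite e mulf_eq0 negb_or => /andP[G0 H0].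
  have dC : dehom K G' * dehom K H' = fchart p k K by rewrite -rmorphM -e dehom_curve.
  have f0 : fchart p k K != 0 by rewrite -size_poly_eq0 sf.
  move: (f0); rewrite -dC mulf_eq0 negb_or => /andP[dG0 dH0].
  have := size_mul dG0 dH0; rewrite dC sf.
  have := msizeM G0 H0; rewrite -e sC.
  have := size_dehom_le H'; move: sG dG0; rewrite -size_poly_gt0.
  have : (0 < msize G')%N by rewrite lt0n msize_poly_eq0.
  have : (0 < msize H')%N by rewrite lt0n msize_poly_eq0.
  move: (msize G') (msize H') (size _) (size _) (q ^ 2 * q.-1)%N => a b c d n.
  by clear; lia.
have := dehom_curve pr_p k_gt0 chK; rewrite CGH rmorphM => /esym.
case/(fchart_irreducible pr_p k_gt0 chK) => [/(half _ _ CGH)|]; first by left.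
by rewrite mulrC in CGH => /(half _ _ CGH); right.
Qed.

(** Fixing the point makes the last column zero above the diagonal, and the upper left block is then
    inverted by the same block of the inverse matrix. *)
Lemma stab_e2_entries (A : 'M[K]_3) : in_stab_point q e2 A ->
  [/\ A i0 i2 = 0, A i1 i2 = 0, A i2 i2 != 0 & A i0 i0 * A i1 i1 - A i0 i1 * A i1 i0 != 0].
Proof.
move=> [_ [uA [c Ac]]].
have col i : A i i2 = c * (i == i2)%:R.
  have /matrixP /(_ i 0) := Ac; rewrite !mxE (bigD1 i2) //= big1 ?addr0.
    by rewrite !mxE !eqxx mulr1 andbT.
  by move=> j nj; rewrite mxE (negPf nj) mulr0.
have c0 : A i0 i2 = 0 by rewrite col mulr0.
have c1 : A i1 i2 = 0 by rewrite col mulr0.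
have VA := mulVmx uA; have AV := mulmxV uA; move: (invmx A) VA AV => N NA AN.
have ent (M : 'M[K]_3) i j : M = 1%:M -> M i j = (i == j)%:R by move=> ->; rewrite mxE.
split => //.
  have := ent _ i2 i2 NA; rewrite !mxE big_ord3 /= c0 c1 !mulr0 !add0r.
  by move=> /eqP; apply: contraTneq => ->; rewrite mulr0 eq_sym oner_eq0.
have e00 := ent _ i0 i0 AN; have e01 := ent _ i0 i1 AN.
have e10 := ent _ i1 i0 AN; have e11 := ent _ i1 i1 AN.
move: e00 e01 e10 e11; rewrite !mxE !big_ord3 /= c0 c1 !mul0r !addr0 /= => e00 e01 e10 e11.
have : (A i0 i0 * A i1 i1 - A i0 i1 * A i1 i0) * (N i0 i0 * N i1 i1 - N i0 i1 * N i1 i0) = 1.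
  transitivity ((A i0 i0 * N i0 i0 + A i0 i1 * N i1 i0) * (A i1 i0 * N i0 i1 + A i1 i1 * N i1 i1)
    - (A i0 i0 * N i0 i1 + A i0 i1 * N i1 i1) * (A i1 i0 * N i0 i0 + A i1 i1 * N i1 i0)).
    by ring.
  by rewrite e00 e01 e11 mul0r subr0 mulr1.
by apply: contra_eq_neq => ->; rewrite mul0r eq_sym oner_neq0.
Qed.

Lemma curve_stab_e2 : curve_invariant (in_stab_point q e2) (curve p k K).
Proof.
move=> A stA; exists 1; rewrite scale1r.
have [c0 c1 h0 det0] := stab_e2_entries stA; have [FA _] := stA.
have L0 : Lform p k 'X_i0 'X_i1 != 0 :> {mpoly K[3]}.
  apply: contraNneq (Lform_neq0 K pr_p k_gt0) => L0.
  by rewrite -[X in _ == X](rmorph0 (dehom K)) -L0 rmorph_Lform dehomX0 dehomX1.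
pose e : {rmorphism K -> {mpoly K[3]}} := @mpolyC 3 K.
have eE c (P : {mpoly K[3]}) : c *: P = e c * P by rewrite -mul_mpolyC.
rewrite /curve (rmorph_Cform _ _ (comp_mpoly (lin_subst A))) /= !lin_substX !lin_substE.
rewrite c0 c1 !scale0r !addr0 !eE.
exact: (Cform_invariant pr_p k_gt0 chK e _ L0 det0 h0).
Qed.

(** A root r of F(x,1,0) gives the factor X - rY; if this polynomial is a nonzero constant, F is a
    multiple of Y^d. *)
Lemma binary_form_linear_factor d (F : {mpoly K[3]}) : F \is [in K[3], d.-homog] -> (0 < d)%N ->
  (forall m, m \in msupp F -> m i2 = 0%N) ->
  exists L G, [/\ L \is [in K[3], 1.-homog], L != 0 & F = L * G].
Proof.
move=> hF d0 h2; pose a := (dehom K F)`_0.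
have hX i : ('X_i : {mpoly K[3]}) \is [in K[3], 1.-homog] by rewrite dhomogX /= mdeg1.
have nX i : ('X_i : {mpoly K[3]}) != 0 by rewrite -msize_poly_eq0 msizeX.
have deg m : m \in msupp F -> (m i0 + m i1)%N = d.
  by move=> hm; rewrite -(dhomog_mdeg hF hm) mdeg3 (h2 m hm) addn0.
have [/closed_rootP [r /rootP ar]|] := boolP (size a != 1%N); last first.
  rewrite negbK => /eqP sa.
  have [|G FG] := @mpolyX_dvd K i1 F; last by exists 'X_i1, G.
  move=> m hm; rewrite -(ltn_add2l (m i0)) addn0 (deg m hm).
  have : a`_(m i0) != 0.
    by have := coef_dehom hF hm; rewrite (h2 m hm) -/a => ->; rewrite -mcoeff_msupp.
  case: (m i0) => // n; rewrite nth_default ?eqxx // sa //.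
pose T (m : 'X_{1..3}) := \sum_(i < m i0) 'X_i0 ^+ ((m i0).-1 - i) * (r *: 'X_i1) ^+ i : {mpoly K[3]}.
exists ('X_i0 - r *: 'X_i1), (\sum_(m <- msupp F) F@_m *: (T m * 'X_i1 ^+ m i1)); split.
- by rewrite rpredB // rpredZ.
- apply: contraTneq (oner_neq0 K) => L0; rewrite negbK.
  have /(congr1 (mcoeff U_(i0))) := L0.
  by rewrite mcoeffB mcoeffZ !mcoeffXU mcoeff0 /= mulr0 subr0 => /eqP.
have aE : \sum_(m <- msupp F) F@_m * r ^+ m i0 = 0.
  rewrite -[RHS]ar /a dehomE coef_sum horner_sum.
  apply: eq_big_seq => m hm; rewrite (h2 m hm) expr0 mulr1 coefC eqxx.
  by rewrite hornerZ hornerXn.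
(* Subtracting this zero multiple of Y^d turns each X^n Y^(d-n) into (X^n - (rY)^n) Y^(d-n), which X
   - rY divides with quotient [T m] times Y^(d-n). *)
have aE' : (\sum_(m <- msupp F) F@_m * r ^+ m i0)%:MP * 'X_i1 ^+ d = 0 :> {mpoly K[3]}.
  by rewrite aE mpolyC0 mul0r.
rewrite {1}(mpolyE F) mulr_sumr -[LHS]subr0 -[X in _ - X = _]aE'.
rewrite rmorph_sum mulr_suml -sumrB; apply: eq_big_seq => m hm.
rewrite -scalerAr mulrA -subrXX mpolyX3 (h2 m hm) expr0 mulr1 -!mul_mpolyC.
rewrite -(deg m hm) exprD rmorphM rmorphXn exprMn /=; ring.
Qed.

(** Repeating the translation q times gives the identity, so chi^q = 1 and (chi - 1)^q = 0. *)
Lemma translation_char (f : K -> K) (chi l : K) : (forall z, f (z + l) = chi * f z) ->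
  f 0 != 0 -> chi = 1.
Proof.
move=> hf f0; have it n : f (l *+ n) = chi ^+ n * f 0.
  elim: n => [|n IHn]; first by rewrite expr0 mul1r.
  by rewrite mulrSr hf IHn exprS mulrA.
have q0 : q%:R = 0 :> K.
  by rewrite natrX (pcharf0 chK) expr0n; case: k k_gt0.
have := it q; rewrite -mulr_natl q0 mul0r -[LHS]mul1r => /(mulIf f0) chiq.
apply/eqP; rewrite -subr_eq0 -[_ == 0]andTb.
have : (chi - 1) ^+ q == 0 by rewrite (frobB k pr_p chK (idK K)) -chiq expr1n subrr.
by rewrite expf_eq0 => /andP[_ ->].
Qed.

(** As a substitution it fixes X and Y and sends Z to aX + bY + cZ. *)
Definition affine_mx (c a b : K) : 'M[K]_3 :=
  \matrix_(i, j) (if i == i2 then (if j == i2 then c else if j == i0 then a else b)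
                  else (i == j)%:R).

Lemma affine_mx_stab (c a b : K) : c != 0 -> c ^+ q = c -> a ^+ q = a -> b ^+ q = b ->
  in_stab_point q e2 (affine_mx c a b).
Proof.
move=> c0 hc ha hb; split; [|split].
- move=> i j; rewrite mxE; case: ifP => _; first by case: ifP => _ //; case: ifP.
  by case: (i == j); rewrite ?expr1n // expr0q.
- suff : affine_mx c a b *m affine_mx c^-1 (- a / c) (- b / c) = 1%:M by case/mulmx1_unit.
  apply/matrixP; apply: ord3P; apply: ord3P; rewrite !mxE big_ord3 !mxE /=;
  rewrite ?mulr0 ?mul0r ?mulr1 ?mul1r ?addr0 ?add0r ?mulfV //.
  + by rewrite mulrC divfK // subrr.
  + by rewrite mulrC divfK // subrr.
- exists c; apply/matrixP => i j; rewrite !mxE (bigD1 i2) //= big1 ?addr0.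
    by rewrite !mxE eqxx; move: i; apply: ord3P; rewrite /= ?eqxx ?mul0r ?mulr0 //=.
  by move=> l nl; rewrite !mxE (negPf nl) mulr0.
Qed.

Lemma ev2_affine (x z c a b : K) (F : {mpoly K[3]}) :
  ev2 (idK K) x z (dehom K (F \mPo lin_subst (affine_mx c a b))) =
  ev2 (idK K) x (c * z + (a * x + b)) (dehom K F).
Proof.
pose f : {rmorphism {mpoly K[3]} -> K} :=
  ev2 (idK K) x z \o dehom K \o comp_mpoly (lin_subst (affine_mx c a b)).
pose g : {rmorphism {mpoly K[3]} -> K} := ev2 (idK K) x (c * z + (a * x + b)) \o dehom K.
have fE D : f D = ev2 (idK K) x z (dehom K (D \mPo lin_subst (affine_mx c a b))) by [].
have gE D : g D = ev2 (idK K) x (c * z + (a * x + b)) (dehom K D) by [].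
have dC t : dehom K t%:MP = (t%:P)%:P by rewrite dehomC.
have evS y t (D : {mpoly K[3]}) s : ev2 (idK K) y t (dehom K (s *: D)) = s * ev2 (idK K) y t (dehom K D).
  by rewrite -mul_mpolyC !rmorphM dC ev2C ev1C.
have X i : f 'X_i = affine_mx c a b i i0 * x + (affine_mx c a b i i1 + affine_mx c a b i i2 * z).
  rewrite fE lin_substX lin_substE !rmorphD !evS dehomX0 dehomX1 dehomX2.
  by rewrite ev2C ev1X rmorph1 mulr1 ev2Z.
apply: (mpoly_rmorph_eq (f := f) (g := g)).
- by move=> t; rewrite fE gE comp_mpolyC dC !ev2C !ev1C.
- by rewrite X gE dehomX0 ev2C ev1X !mxE /= mul1r mul0r !addr0.
- by rewrite X gE dehomX1 rmorph1 !mxE /= !mul0r add0r addr0.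
- by rewrite X gE dehomX2 ev2Z !mxE /=; ring.
Qed.

Lemma degree_bound_e2 d (F : {mpoly K[3]}) : (1 < d)%N ->
  invariant_irreducible_curve (in_stab_point q e2) d F -> (q ^ 3 - q ^ 2 <= d)%N.
Proof.
move=> d1 [hF [irF invF]]; have d0 := ltnW d1.
have F0 : F != 0 by case: irF => sF _; apply: contraTneq sF => ->; rewrite msize0.
(* F involves Z, since a binary form of degree d > 1 has a linear factor. *)
have [m2 hm2 m2z] : exists2 m, m \in msupp F & (0 < m i2)%N.
  apply/hasP; apply: contraT; rewrite -all_predC => /allP h.
  have [|L [G [hL L0 FLG]]] := @binary_form_linear_factor d F hF d0.
    by move=> m /h /=; rewrite lt0n negbK => /eqP.
  by case: (irreducible_no_linear_factor hF d1 irF hL L0 FLG).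
(* F is not divisible by Z. *)
have [m0 hm0 m0z] : exists2 m, m \in msupp F & m i2 = 0%N.
  have /hasP [m hm /eqP e] : has (fun m : 'X_{1..3} => m i2 == 0%N) (msupp F).
    apply: contraT; rewrite -all_predC => /allP h.
    have [|G FG] := @mpolyX_dvd K i2 F; first by move=> m /h; rewrite lt0n.
    have hX : ('X_i2 : {mpoly K[3]}) \is [in K[3], 1.-homog] by rewrite dhomogX /= mdeg1.
    have nX : ('X_i2 : {mpoly K[3]}) != 0 by rewrite -msize_poly_eq0 msizeX.
    by case: (irreducible_no_linear_factor hF d1 irF hX nX FG).
  by exists m.
pose f := dehom K F.
have f0 : f`_0 != 0.
  have := coef_dehom hF hm0; rewrite m0z => e.
  by move: (hm0); rewrite mcoeff_msupp -e; apply: contraNneq; rewrite -/f => ->; rewrite coef0.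
have sf : (1 < size f)%N.
  rewrite (leq_trans _ (_ : (m2 i2).+1 <= _)%N) // ltnNge.
  apply/negP => sf; move: (hm2); rewrite mcoeff_msupp -(coef_dehom hF hm2) -/f.
  by rewrite (nth_default _ sf) coef0 eqxx.
have lf : lead_coef f != 0 by rewrite lead_coef_eq0 -size_poly_gt0 ltnW.
pose u : {poly K} := 'X^q - 'X.
have u0 : u != 0.
  rewrite -size_poly_eq0 size_polyDl size_polyXn // size_polyN size_polyX ltnS.
  exact: q_gt1.
(* This x0 lies outside F_q and keeps the constant and leading coefficients in z nonzero: [g] has
   the size of [f], and [g.[0]] is nonzero, which will force the characters of translations and
   scalings to be 1. *)
have [x0] := closed_field_nonroot (mulf_neq0 u0 (mulf_neq0 f0 lf)).
rewrite !hornerM !mulf_eq0 !negb_or !hornerE subr_eq0 => /andP[/andP[hx fx] lx].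
pose g := map_poly (ev1 (idK K) x0) f.
have ev1E (P : {poly K}) : ev1 (idK K) x0 P = P.[x0].
  by rewrite -[LHS]/((map_poly idfun P).[x0]) map_poly_id.
have gE z : g.[z] = ev2 (idK K) x0 z f by [].
have sg : size g = size f by rewrite size_map_poly_id0 // ev1E.
have g0 : g.[0] != 0 by rewrite horner_coef0 coef_map /= -[X in X != 0]/(ev1 (idK K) x0 _) ev1E.
have gA c a b : c != 0 -> c ^+ q = c -> a ^+ q = a -> b ^+ q = b ->
    exists chi, forall z, g.[c * z + (a * x0 + b)] = chi * g.[z].
  move=> c0 hc ha hb; have [chi Fchi] := invF _ (affine_mx_stab c0 hc ha hb).
  exists chi => z; rewrite !gE -ev2_affine Fchi -mul_mpolyC !rmorphM dehomC ev2C ev1C //.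
have zero_q : (0 : K) ^+ q = 0 by apply: expr0q.
rewrite cube_minus_square.
rewrite -ltnS; apply: leq_trans (msize_dhomog_le hF).
apply: leq_trans (size_dehom_le F); rewrite -/f -sg.
apply: (size_affine_invariant pr_p k_gt0 chK hx).
- move=> a b z ha hb; have [chi hchi] := gA 1 a b (oner_neq0 K) (expr1n _ _) ha hb.
  have hz t : g.[t + (a * x0 + b)] = chi * g.[t] by rewrite -hchi mul1r.
  by rewrite hz (translation_char hz g0) mul1r.
- move=> c z c0 hc; have [chi hchi] := gA c 0 0 c0 hc zero_q zero_q.
  have hz t : g.[c * t] = chi * g.[t] by rewrite -hchi mul0r !addr0.
  have := hz 0; rewrite mulr0 -[LHS]mul1r => /(mulIf g0) chi1.
  by rewrite hz -chi1 mul1r.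
- by rewrite sg.
Qed.

(** * Transport to an arbitrary point of PG(2,q) *)

Lemma entries_in_Fq_mul m n r (A : 'M[K]_(m, n)) (B : 'M[K]_(n, r)) :
  entries_in_Fq q A -> entries_in_Fq q B -> entries_in_Fq q (A *m B).
Proof.
move=> hA hB i j; rewrite !mxE.
apply: (big_ind (fun x : K => x ^+ q = x)); first exact: expr0q.
  by move=> x y hx hy; rewrite (frobD k pr_p chK (idK K)) hx hy.
by move=> l _; rewrite exprMn hA hB.
Qed.

(** If A fixes the point P1, then MAN fixes P2, and MA = (MAN)M carries the invariance over. *)
Lemma invariant_curve_conj (M N : 'M[K]_3) (P1 P2 : 'cV[K]_3) d F :
  entries_in_Fq q M -> entries_in_Fq q N -> M *m N = 1%:M -> M *m P1 = P2 ->
  invariant_irreducible_curve (in_stab_point q P2) d F ->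
  invariant_irreducible_curve (in_stab_point q P1) d (F \mPo lin_subst M).
Proof.
move=> hM hN MN MP [hF [irF invF]]; split; first exact: lin_subst_dhomog.
split; first exact: irreducible_lin_subst MN irF.
move=> A [hA [uA [c Ac]]]; have NM := mulmx1C MN.
have [|chi Fchi] := invF (M *m A *m N).
  split; first by do 2!apply: entries_in_Fq_mul => //.
  split.
    have [uM _] := mulmx1_unit MN; have [uN _] := mulmx1_unit NM.
    by rewrite !unitmx_mul uM uA.
  by exists c; rewrite -MP -!mulmxA (mulmxA N) NM mul1mx Ac scalemxAr.
exists chi; rewrite lin_subst_mul -[M *m A]mulmx1 -NM mulmxA -lin_subst_mul Fchi.
by rewrite comp_mpolyZ.
Qed.

Lemma move_to_e2 (P : 'cV[K]_3) : entries_in_Fq q P -> P != 0 ->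
  exists M N : 'M[K]_3,
    [/\ entries_in_Fq q M, entries_in_Fq q N, M *m N = 1%:M & M *m e2 = P].
Proof.
move=> hP P0; have [i Pi] : exists i, P i 0 != 0.
  apply/existsP; apply: contraNT P0; rewrite negb_exists => /forallP h.
  by apply/eqP/matrixP => i j; rewrite ord1 mxE; apply/eqP; rewrite -[_ == _]negbK h.
have Fq_nat (b : bool) : b%:R ^+ q = b%:R :> K by case: b; rewrite ?expr1n // expr0q.
pose v : 'cV[K]_3 := P - delta_mx i 0; pose w : 'rV[K]_3 := delta_mx 0 i.
have hv : entries_in_Fq q v.
  by move=> j l; rewrite !mxE (frobB k pr_p chK (idK K)) hP Fq_nat.
have hvw : entries_in_Fq q (v *m w).
  by apply: entries_in_Fq_mul => // j l; rewrite mxE Fq_nat.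
have wE (x : 'cV[K]_3) : w *m x = (x i 0)%:M.
  by rewrite -rowE; apply/matrixP => j l; rewrite !ord1 !mxE.
pose T : 'M[K]_3 := tperm_mx i i2.
have hT : entries_in_Fq q T by move=> j l; rewrite !mxE Fq_nat.
have TT : T *m T = 1%:M by rewrite -perm_mxM tperm2 perm_mx1.
have Te : T *m e2 = delta_mx i 0.
  rewrite -row_permE; apply/matrixP => j l; rewrite !mxE (can2_eq (tpermK _ _) (tpermK _ _)).
  by rewrite tpermR.
(* [T] moves e2 to the basis vector e_i, and 1 + vw moves e_i to e_i + v = P. Since wv = P_i - 1,
   the inverse of 1 + vw is 1 - vw / P_i. *)
exists ((1%:M + v *m w) *m T), (T *m (1%:M - (P i 0)^-1 *: (v *m w))); split.
- apply: entries_in_Fq_mul => // j l; rewrite mxE (frobD k pr_p chK (idK K)) hvw.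
  by rewrite mxE Fq_nat.
- apply: entries_in_Fq_mul => // j l; rewrite !mxE (frobB k pr_p chK (idK K)) Fq_nat.
  by have := hvw j l; rewrite mxE exprMn exprVn hP => ->.
- rewrite -mulmxA (mulmxA T) TT mul1mx mulmxDl mul1mx mulmxBr mulmx1 -scalemxAr.
  rewrite -(mulmxA v) (mulmxA w) wE mul_scalar_mx -scalemxAr scalerA.
  rewrite !mxE !eqxx /= -addrA -[RHS]addr0; congr (_ + _).
  rewrite -[X in _ + (X - _)]scale1r -scalerBl -scaleNr -scalerDl.
  have -> : - (P i 0)^-1 + (1 - (P i 0)^-1 * (P i 0 - 1)) = 0 by rewrite mulrBr mulVf // mulr1; ring.
  by rewrite scale0r.
- rewrite -mulmxA Te mulmxDl mul1mx -mulmxA wE mxE !eqxx mul_mx_scalar scale1r.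
  by rewrite addrC subrK.
Qed.

End InvariantCurves.

Theorem mainTheorem4 (p k : nat) (K : closedFieldType) (P : 'cV[K]_3) :
  prime p -> (0 < k)%N -> p \in [pchar K] ->
  (* K is an algebraic closure of F_q, q = p^k: every element lies in some F_(q^n) *)
  (forall x : K, exists n : nat, (0 < n)%N /\ x ^+ ((p ^ k) ^ n) = x) ->
  (* P is a point of PG(2,q) *)
  entries_in_Fq (p ^ k) P -> P != 0 ->
  let q := (p ^ k)%N in
  let G := in_stab_point q P in
  (exists F : {mpoly K[3]}, invariant_irreducible_curve G (q ^ 3 - q ^ 2) F) /\
  (forall (d : nat) (F : {mpoly K[3]}),
      (1 < d)%N -> invariant_irreducible_curve G d F -> (q ^ 3 - q ^ 2 <= d)%N).
Proof.
move=> pr_p k_gt0 chK _ hP P0 q G.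
have [M [N [hM hN MN MP]]] := move_to_e2 pr_p k_gt0 chK hP P0.
have NM := mulmx1C MN.
have NP : N *m P = @e2 K by rewrite -MP mulmxA NM mul1mx.
split.
  exists (curve p k K \mPo lin_subst N).
  apply: (invariant_curve_conj pr_p k_gt0 chK hN hM NM NP); split.
    exact: curve_dhomog.
  by split; [apply: curve_irreducible|apply: curve_stab_e2].
move=> d F d1 invF; apply: (degree_bound_e2 pr_p k_gt0 chK d1 (F := F \mPo lin_subst M)).
exact: (invariant_curve_conj pr_p k_gt0 chK hM hN MN MP invF).
Qed.
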